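(* Let $\epsilon>0$. Then the set $$\left\{m\in\mathbb{Z}^+ \;\middle|\; \text{for all integers } k \text{ with } 0\leq k\leq \frac{3\log_2 m}{2-\log_2 3}:\ \left(\sqrt[3]{\tfrac{3}{4}}\right)^{k}m^{1-\epsilon}\leq \mathsf{Col}^k(m)\leq \left(\sqrt[3]{\tfrac{3}{4}}\right)^k m^{1+\epsilon}\right\}$$ is of natural density $1$.
   Context: $\mathbb{Z}^+$ is the set of positive integers. The Collatz map $\mathsf{Col}:\mathbb{Z}^+\to\mathbb{Z}^+$ is defined by $\mathsf{Col}(m)=\frac{m}{2}$ if $m$ is even and $\mathsf{Col}(m)=3m+1$ if $m$ is odd; $\mathsf{Col}^k$ denotes its $k$-fold iterate ($\mathsf{Col}^0$ is the identity). A set $A\subseteq\mathbb{Z}^+$ is of natural density $1$ if $\liminf_{n\to\infty}\frac{\#\{m\in A\mid m\leq n\}}{n}=1$. *)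

(* Defs.v *)
From HB Require Import structures.
From mathcomp Require Import all_boot all_order all_algebra.
From mathcomp Require Import all_classical all_reals all_analysis.

Set Implicit Arguments.
Unset Strict Implicit.
Unset Printing Implicit Defensive.

Import Order.TTheory GRing.Theory Num.Theory.

Local Open Scope classical_set_scope.
Local Open Scope ring_scope.

(* The positive integers are the [m : nat] with [0 < m]; [Col] maps them to
   themselves, and its value at 0 plays no role. *)
Definition Col (m : nat) : nat :=
  if odd m then (3 * m + 1)%N else (m %/ 2)%N.

Definition log2 (R : realType) (x : R) : R := ln x / ln 2.

Definition count_upto (A : set nat) (n : nat) : nat :=
  #|[pred m : 'I_n.+1 | (0 < m)%N && (val m \in A)]|.

(* The liminf is taken in [\bar R], where it exists for every sequence; the
   term at n = 0 is a junk quotient that does not affect it. *)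
Definition natural_density_one (R : realType) (A : set nat) : Prop :=
  limn_einf (fun n : nat => ((count_upto A n)%:R / n%:R : R)%:E) = 1%E.

(* Main.v *)
Require Import Defs.
From HB Require Import structures.
From mathcomp Require Import all_boot all_order all_algebra.
From mathcomp Require Import all_classical all_reals all_analysis.
From mathcomp Require Import zify ring lra.

(** Write the Collatz map with its forced halving built in: [shortcut] sends an
even m to m / 2 and an odd m to (3 m + 1) / 2.  If w is the word of parities
met in n steps, then
    2 ^ n * iter n shortcut m = 3 ^ ones w * m + offset w,
and m |-> w is a bijection from [0, 2 ^ n) to the words of length n.  So for
n steps the parities of a random m < 2 ^ n are independent fair coins, half of
the steps are odd, and m is multiplied by about (3 / 4) ^ (n / 2); what remains
is a number of size about 2 ^ (rho n), rho = ln 3 / (2 ln 2) < 1.  If this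
number were again generic, iterating would give control for
n (1 + rho + rho ^ 2 + ...) = n / (1 - rho) shortcut steps, which is exactly
the range of the theorem.

The numbers below 2 ^ n' whose parities are unbalanced form a set of size
2 ^ (n' (1 - c)) ([concentrated]).  To pull such a set back through n steps one
has to know that, after removing a power-saving set of m, no y has more than
2 ^ (n (1 + e)) / 3 ^ (n / 2) preimages m < 2 ^ n.  A preimage of y is a word w
with offset w = 2 ^ n y modulo 3 ^ ones w.  So the question is whether the
offsets of random words are equidistributed modulo 3 ^ (n / 2), up to factors
2 ^ (e n): whether a certain self-similar measure on the 3-adic integers has
full dimension.

Full dimension ([low_bias_all]) is proved as follows.  The conditional law of
the j-th ternary digit of the offset, given the lower ones, is a measure on
Z/3, and [bias j] adds up over all lower digits the spread (maximum minus
minimum) of these measures.  Three facts suffice.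
 - Spread is subadditive, and submultiplicative for convolution on Z/3.  As
   offset (u ++ v) = 3 ^ ones v * offset u + 2 ^ |u| * offset v
   is a sum of two independent terms once ones v is fixed, the bias of long
   words at level j is at most the bias of u at level j - ones v times the bias
   of v at level j ([bias_conv], [offset_bias_cat]).
 - Consequently low bias at one level propagates to all higher levels
   ([offset_bias_propagate]).
 - The 2 ^ n words of length n have about 3 ^ (n / 2) = 2 ^ (0.79 n) residues
   modulo 3 ^ (n / 2), so the higher digits must still carry information: at
   some level j well above n / 2 they are not almost determined, and there the
   bias is at most 89 / 90 of its trivial bound ([some_unbiased_level]).
Using such a v as a suffix multiplies the limiting bias by a constant below 1,
hence the limiting bias is 0.

Low bias yields a block length p for which most words v of length p are good:
few words share the residue of offset v modulo 3 ^ J, with J close to p / 2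
([most_blocks_good]).  Cut a long word into blocks.  All but a power-saving set
of words have few bad blocks ([many_bad_blocks]).  Going backwards from y, a
good block can be chosen in at most about 2 ^ p / 3 ^ (p / 2) ways, so few
words with few bad blocks lead to y ([fiber_good_blocks]).  This gives the
induction step from al to 1 + rho al ([concentrated_step]), and with it every
al < 1 / (1 - rho).  In the short remaining time the orbit moves by a factor at
most 2 ^ (e n), which m ^ eps absorbs ([Col_log_bounds]). *)

Set Implicit Arguments.
Unset Strict Implicit.
Unset Printing Implicit Defensive.

Import Order.TTheory GRing.Theory Num.Theory.

(** * Spread of a measure on Z/3 and its convolutions *)

(** The total variation between a measure on Z/3 with masses a, b, c and its
translates.  It is used in place of a Fourier coefficient because it is an
integer, a seminorm, and submultiplicative. *)
Definition spread (a b c : nat) : nat := maxn a (maxn b c) - minn a (minn b c).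

Lemma spread_add a b c a' b' c' :
  spread (a + a') (b + b') (c + c') <= spread a b c + spread a' b' c'.
Proof. by rewrite /spread; lia. Qed.

Lemma spread_rot a b c : spread b c a = spread a b c.
Proof. by rewrite /spread; lia. Qed.

Lemma spread_swap a b c : spread a c b = spread a b c.
Proof. by rewrite /spread; lia. Qed.

Lemma spread_le a b c d :
  (a <= b + d) -> (b <= a + d) -> (b <= c + d) -> (c <= b + d) ->
  (a <= c + d) -> (c <= a + d) -> spread a b c <= d.
Proof. by rewrite /spread; lia. Qed.

(** The differences x - y add up to 0, so their positive and negative parts are
equal; one of the two comes from a single term, so both are at most al. *)
Lemma zero_sum_pairing x0 x1 x2 y0 y1 y2 b0 b1 b2 m al q be :
  x0 + x1 + x2 = y0 + y1 + y2 ->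
  m <= x0 <= m + al -> m <= x1 <= m + al -> m <= x2 <= m + al ->
  m <= y0 <= m + al -> m <= y1 <= m + al -> m <= y2 <= m + al ->
  q <= b0 <= q + be -> q <= b1 <= q + be -> q <= b2 <= q + be ->
  x0 * b0 + x1 * b1 + x2 * b2 <= y0 * b0 + y1 * b1 + y2 * b2 + al * be.
Proof.
move=> s h0 h1 h2 g0 g1 g2 hb0 hb1 hb2.
have [c0 [e0 l0]] : exists c, b0 = q + c /\ c <= be by exists (b0 - q); lia.
have [c1 [e1 l1]] : exists c, b1 = q + c /\ c <= be by exists (b1 - q); lia.
have [c2 [e2 l2]] : exists c, b2 = q + c /\ c <= be by exists (b2 - q); lia.
rewrite {}e0 {}e1 {}e2 {hb0 hb1 hb2}.
suff : x0 * c0 + x1 * c1 + x2 * c2 <= y0 * c0 + y1 * c1 + y2 * c2 + al * be.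
  by nia.
by case: (leqP x0 y0) => i0; case: (leqP x1 y1) => i1;
  case: (leqP x2 y2) => i2; nia.
Qed.

(** A difference of two values of the convolution pairs b with a translate of a
minus another translate; such a difference has sum 0. *)
Lemma spread_conv a0 a1 a2 b0 b1 b2 :
  spread (a0 * b0 + a1 * b2 + a2 * b1)
         (a0 * b1 + a1 * b0 + a2 * b2)
         (a0 * b2 + a1 * b1 + a2 * b0) <= spread a0 a1 a2 * spread b0 b1 b2.
Proof.
have [al [m ha]] : exists al m, al = spread a0 a1 a2 /\
   [/\ m <= a0 <= m + al, m <= a1 <= m + al & m <= a2 <= m + al].
  exists (spread a0 a1 a2), (minn a0 (minn a1 a2)); split=> //; split; rewrite /spread; lia.
have [be [q hb]] : exists be q, be = spread b0 b1 b2 /\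
   [/\ q <= b0 <= q + be, q <= b1 <= q + be & q <= b2 <= q + be].
  exists (spread b0 b1 b2), (minn b0 (minn b1 b2)); split=> //; split; rewrite /spread; lia.
case: ha => <- [ha0 ha1 ha2]; case: hb => <- [hb0 hb1 hb2].
have -> : a0 * b0 + a1 * b2 + a2 * b1 = a0 * b0 + a2 * b1 + a1 * b2 by lia.
have -> : a0 * b1 + a1 * b0 + a2 * b2 = a1 * b0 + a0 * b1 + a2 * b2 by lia.
have -> : a0 * b2 + a1 * b1 + a2 * b0 = a2 * b0 + a1 * b1 + a0 * b2 by lia.
by apply: spread_le; apply: (@zero_sum_pairing _ _ _ _ _ _ _ _ _ m _ q); lia.
Qed.

(** * Digit bias of a list of naturals *)

Definition residue_count (M : nat) (X : seq nat) (r : nat) : nat :=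
  count (fun x => x == r %[mod M]) X.

(** The sum over r < 3 ^ j of the spread of the j-th ternary digit among the
elements of X congruent to r modulo 3 ^ j.  It lies between 0, when these
digits are uniform given the lower ones, and the size of X, when they are
determined by the lower ones. *)
Definition bias (j : nat) (X : seq nat) : nat :=
  \sum_(r < 3 ^ j) spread (residue_count (3 ^ j.+1) X r)
                          (residue_count (3 ^ j.+1) X (r + 3 ^ j))
                          (residue_count (3 ^ j.+1) X (r + 2 * 3 ^ j)).

Lemma spread_sum (I : Type) (s : seq I) (a b c : I -> nat) :
  spread (\sum_(i <- s) a i) (\sum_(i <- s) b i) (\sum_(i <- s) c i)
    <= \sum_(i <- s) spread (a i) (b i) (c i).
Proof.
elim: s => [|i s IH]; first by rewrite !big_nil.
rewrite !big_cons; apply: leq_trans (spread_add _ _ _ _ _ _) _.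
by rewrite leq_add2l.
Qed.

Lemma count_by_key (T : Type) (k : T -> nat) (N : nat) (P : pred T) (Z : seq T) :
  all (fun z => k z < N) Z ->
  count P Z = \sum_(p < N) count P [seq z <- Z | k z == p].
Proof.
elim: Z => [_|z Z IH /= /andP[zN /IH->]]; first by rewrite big1.
have -> : \sum_(p < N) count P (if k z == p then z :: [seq z <- Z | k z == p]
             else [seq z <- Z | k z == p])
   = \sum_(p < N) ((k z == p) * P z + count P [seq z <- Z | k z == p]).
  by apply: eq_bigr => p _; case: (k z == p); rewrite /= ?mul1n.
rewrite big_split /= -big_distrl /=; congr addn.
rewrite (bigD1 (Ordinal zN)) //= eqxx big1 ?mul1n // => p ne.
by case: eqP => // e; case/eqP: ne; apply: val_inj.
Qed.

(** Conditioning on more information can only raise the bias, by subadditivity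
of the spread. *)
Lemma bias_by_key (T : Type) (k : T -> nat) (N : nat) (f : T -> nat) j Z :
  all (fun z => k z < N) Z ->
  bias j (map f Z) <= \sum_(p < N) bias j (map f [seq z <- Z | k z == p]).
Proof.
move=> kN; rewrite /bias exchange_big /=; apply: leq_sum => r _.
rewrite /residue_count !count_map !(count_by_key _ kN).
apply: leq_trans (spread_sum _ _ _ _) _.
by apply: leq_sum => p _; rewrite !count_map.
Qed.

Lemma bias_cat j X Y : bias j (X ++ Y) <= bias j X + bias j Y.
Proof.
rewrite /bias -big_split /=; apply: leq_sum => r _.
by rewrite /residue_count !count_cat spread_add.
Qed.

Lemma residue_count_mod M X r r' : r = r' %[mod M] -> residue_count M X r = residue_count M X r'.
Proof. by move=> e; apply: eq_count => x /=; rewrite e. Qed.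

(** For a list inside one class modulo 3 ^ j the bias is a single spread, and any
representative R of the class may be used: changing it permutes the three
counts cyclically. *)
Lemma bias_one_class j X R : all (fun x => x == R %[mod 3 ^ j]) X ->
  bias j X <= spread (residue_count (3 ^ j.+1) X R) (residue_count (3 ^ j.+1) X (R + 3 ^ j))
                     (residue_count (3 ^ j.+1) X (R + 2 * 3 ^ j)).
Proof.
move=> /allP XR; have h0 : 0 < 3 ^ j by rewrite expn_gt0.
have rR : R %% 3 ^ j < 3 ^ j by rewrite ltn_mod.
have dvd : 3 ^ j %| 3 ^ j.+1 by rewrite dvdn_exp2l.
rewrite /bias (bigD1 (Ordinal rR)) //= big1 ?addn0; last first.
  move=> r ne; have Z t : residue_count (3 ^ j.+1) X (r + t * 3 ^ j) = 0.
    apply/eqP; rewrite -leqn0 leqNgt -has_count; apply/hasPn => x /XR xR.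
    apply/negP => /eqP /(congr1 (modn ^~ (3 ^ j))); rewrite !modn_dvdm //.
    rewrite addnC modnMDl (modn_small (ltn_ord r)) (eqP xR) => e.
    by case/eqP: ne; apply: val_inj; rewrite /= e.
  by have := (Z 0, Z 1, Z 2); rewrite mul0n mul1n addn0 => -[[-> ->] ->].
set h := 3 ^ j; set r0 := R %% h; rewrite -/h.
have per t : residue_count (3 ^ j.+1) X (r0 + t.+3 * h) = residue_count (3 ^ j.+1) X (r0 + t * h).
  by apply: residue_count_mod; rewrite expnS -/h -[t.+3]addn3 mulnDl addnA modnDr.
have : R = r0 + (R %/ h) * h by rewrite addnC -divn_eq.
have perm t s : residue_count (3 ^ j.+1) X (r0 + (t + 3 * s) * h) = residue_count (3 ^ j.+1) X (r0 + t * h).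
  elim: s t => [|s IH] t; first by rewrite muln0 addn0.
  by rewrite -(IH t) -(per (t + 3 * s)); congr (residue_count _ _ (_ + _ * _)); lia.
move=> ->; rewrite (divn_eq (R %/ h) 3) /h.
have : (R %/ h) %% 3 < 3 by rewrite ltn_mod.
move: (R %/ h %/ 3) (R %/ h %% 3) => s t t3.
have E u : r0 + (s * 3 + t) * 3 ^ j + u * 3 ^ j = r0 + ((t + u) + 3 * s) * h.
  by rewrite /h; nia.
have -> : residue_count (3 ^ j.+1) X (r0 + (s * 3 + t) * 3 ^ j) = residue_count (3 ^ j.+1) X (r0 + t * h).
  rewrite -(perm t s); congr residue_count; rewrite /h; nia.
have := E 1; rewrite mul1n => ->; rewrite (E 2) !perm.
have -> : residue_count (3 ^ j.+1) X r0 = residue_count (3 ^ j.+1) X (r0 + 0 * h) by rewrite mul0n addn0.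
have -> : residue_count (3 ^ j.+1) X (r0 + 3 ^ j) = residue_count (3 ^ j.+1) X (r0 + 1 * h) by rewrite mul1n.
case: t t3 {E} => [|[|[|//]]] _.
- by rewrite !add0n.
- by rewrite -[1 + 1]/2 -[1 + 2]/3 (per 0) [leqRHS]spread_rot.
- by rewrite -[2 + 1]/3 -[2 + 2]/4 (per 0) (per 1) -[leqRHS]spread_rot.
Qed.

Lemma bias_size j X : bias j X <= size X.
Proof.
elim: X => [|x X IH].
  by apply: leq_trans (bias_one_class (R := 0) (j := j) _) _.
rewrite -cat1s; apply: leq_trans (bias_cat _ _ _) _.
rewrite size_cat; apply: leq_add => //.
apply: leq_trans (bias_one_class (R := x) _) _; first by rewrite /= eqxx.
rewrite /residue_count /= !addn0 /spread.
by case: (_ == _); case: (_ == _); case: (_ == _).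
Qed.

Lemma allpairs_filter2 (P Q : pred nat) (X Y : seq nat) :
  [seq z <- [seq z <- [seq (x, y) | x <- X, y <- Y] | P z.1] | Q z.2] =
  [seq (x, y) | x <- [seq x <- X | P x], y <- [seq y <- Y | Q y]].
Proof.
elim: X => //= x X IH; rewrite !filter_cat IH.
have -> : [seq z <- [seq (x, y) | y <- Y] | P z.1] =
    if P x then [seq (x, y) | y <- Y] else [::].
  by elim: Y {IH} => [|y Y /= ->]; case: (P x).
by case: (P x) => //=; congr cat; rewrite filter_map.
Qed.

Lemma count_allpairs (P : pred nat) (f : nat -> nat -> nat) X Y :
  count P [seq f x y | x <- X, y <- Y] = \sum_(x <- X) \sum_(y <- Y) P (f x y).
Proof.
elim: X => [|x X IH]; first by rewrite big_nil.
rewrite allpairs_cons count_cat IH big_cons; congr addn.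
by elim: Y {IH} => [|y Y /= ->]; rewrite ?big_nil // big_cons.
Qed.

Lemma countE (T : Type) (P : pred T) X : count P X = \sum_(x <- X) P x.
Proof. by elim: X => [|x X /= ->]; rewrite ?big_nil // big_cons. Qed.

Lemma residue_count_filter i p s X : p < 3 ^ i -> s < 3 ->
  residue_count (3 ^ i.+1) [seq x <- X | x %% 3 ^ i == p] (p + s * 3 ^ i) =
  residue_count (3 ^ i.+1) X (p + s * 3 ^ i).
Proof.
move=> pi s3; rewrite /residue_count count_filter; apply: eq_count => x /=.
case: (x == _ %[mod _]) / eqP => //= /(congr1 (modn ^~ (3 ^ i))).
rewrite !modn_dvdm ?dvdn_exp2l // [p + _]addnC modnMDl => ->.
by rewrite (modn_small pi) eqxx.
Qed.

Lemma digit_eq i p s x : p < 3 ^ i -> s < 3 -> x %% 3 ^ i = p ->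
  (x == p + s * 3 ^ i %[mod 3 ^ i.+1]) = ((x %/ 3 ^ i) %% 3 == s).
Proof.
move=> pi s3 xp; have -> : (x == p + s * 3 ^ i %[mod 3 ^ i.+1]) =
    (p + x %/ 3 ^ i * 3 ^ i == p + s * 3 ^ i %[mod 3 ^ i.+1]).
  by rewrite -xp [x %% _ + x %/ _ * _]addnC -divn_eq.
by rewrite eqn_modDl expnS -!muln_modl eqn_pmul2r ?expn_gt0 // (modn_small s3).
Qed.

(** Addition in Z/3, written in the form of the convolution that [spread_conv]
bounds. *)
Lemma conv_digit u w : let d s := (u %% 3 == s) : nat in
  let e s := (w %% 3 == s) : nat in
  [/\ ((u + w) %% 3 == 0) = d 0 * e 0 + d 1 * e 2 + d 2 * e 1 :> nat,
      ((u + w) %% 3 == 1) = d 0 * e 1 + d 1 * e 0 + d 2 * e 2 :> nat &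
      ((u + w) %% 3 == 2) = d 0 * e 2 + d 1 * e 1 + d 2 * e 0 :> nat].
Proof.
move=> d e; rewrite {}/d {}/e -modnDm.
have : u %% 3 < 3 by rewrite ltn_mod.
have : w %% 3 < 3 by rewrite ltn_mod.
by move: (u %% 3) (w %% 3) => [|[|[|?]]] [|[|[|?]]].
Qed.

Lemma count_conv (X Y : seq nat) (P : pred nat) (f : nat -> nat -> nat)
    (d e : nat -> nat -> nat) (s0 s1 s2 t0 t1 t2 : nat) :
  (forall x y, x \in X -> y \in Y ->
    P (f x y) = d s0 x * e t0 y + d s1 x * e t1 y + d s2 x * e t2 y :> nat) ->
  count P [seq f x y | x <- X, y <- Y] =
   (\sum_(x <- X) d s0 x) * (\sum_(y <- Y) e t0 y) +
   (\sum_(x <- X) d s1 x) * (\sum_(y <- Y) e t1 y) +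
   (\sum_(x <- X) d s2 x) * (\sum_(y <- Y) e t2 y).
Proof.
move=> E; rewrite count_allpairs !big_distrlr -!big_split /=.
apply: eq_big_seq => x xX; rewrite -!big_split /=.
by apply: eq_big_seq => y yY; rewrite E.
Qed.

(** Inside one class of x modulo 3 ^ i and one of y modulo 3 ^ (e + i), the digit
of 3 ^ e * x + a * y at level e + i is, up to a constant, the digit of x at
level i plus a times the digit of y.  Multiplication by the unit a of Z/3 at
most exchanges two of the counts of y. *)
Lemma bias_conv_class e i a p q (X Y : seq nat) : coprime a 3 -> p < 3 ^ i ->
    q < 3 ^ (e + i) ->
  all (fun x => x %% 3 ^ i == p) X -> all (fun y => y %% 3 ^ (e + i) == q) Y ->
  bias (e + i) [seq 3 ^ e * x + a * y | x <- X, y <- Y] <=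
  spread (residue_count (3 ^ i.+1) X p) (residue_count (3 ^ i.+1) X (p + 3 ^ i))
         (residue_count (3 ^ i.+1) X (p + 2 * 3 ^ i)) *
  spread (residue_count (3 ^ (e + i).+1) Y q) (residue_count (3 ^ (e + i).+1) Y (q + 3 ^ (e + i)))
         (residue_count (3 ^ (e + i).+1) Y (q + 2 * 3 ^ (e + i))).
Proof.
move=> co pi qj /allP Xp /allP Yq; set j := e + i; set h := 3 ^ j.
have ej : 3 ^ j = 3 ^ e * 3 ^ i by rewrite expnD.
set d := fun s x => ((x %/ 3 ^ i) %% 3 == s) : nat.
set b := fun s y => ((y %/ h) %% 3 == s) : nat.
set b' := fun s y => ((a * (y %/ h)) %% 3 == s) : nat.
have cX s : s < 3 -> residue_count (3 ^ i.+1) X (p + s * 3 ^ i) = \sum_(x <- X) d s x.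
  move=> s3; rewrite /residue_count countE; apply: eq_big_seq => x /Xp/eqP xp.
  by rewrite digit_eq.
have cY s : s < 3 -> residue_count (3 ^ j.+1) Y (q + s * h) = \sum_(y <- Y) b s y.
  move=> s3; rewrite /residue_count countE; apply: eq_big_seq => y /Yq/eqP yq.
  by rewrite digit_eq.
have cls x y : x \in X -> y \in Y ->
    3 ^ e * x + a * y = (3 ^ e * p + a * q) + (x %/ 3 ^ i + a * (y %/ h)) * h.
  move=> /Xp/eqP xp /Yq/eqP yq.
  rewrite {1}(divn_eq x (3 ^ i)) {1}(divn_eq y h) xp yq /h ej; nia.
have key x y t : x \in X -> y \in Y -> t < 3 ->
   (3 ^ e * x + a * y == (3 ^ e * p + a * q) + t * h %[mod 3 ^ j.+1]) =
   ((x %/ 3 ^ i + a * (y %/ h)) %% 3 == t).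
  move=> xX yY t3; rewrite cls // eqn_modDl expnS -!muln_modl.
  by rewrite eqn_pmul2r ?expn_gt0 // (modn_small t3).
apply: leq_trans (bias_one_class (R := 3 ^ e * p + a * q) _) _.
  apply/allP => _ /allpairsP [[x y] /= [xX yY ->]].
  by rewrite cls // addnC modnMDl.
have := (cX 0, cX 1, cX 2); rewrite mul0n mul1n addn0 => -[[-> // -> //] -> //].
have := (cY 0, cY 1, cY 2); rewrite mul0n mul1n addn0 => -[[-> // -> //] -> //].
have -> : spread (\sum_(y <- Y) b 0 y) (\sum_(y <- Y) b 1 y) (\sum_(y <- Y) b 2 y)
   = spread (\sum_(y <- Y) b' 0 y) (\sum_(y <- Y) b' 1 y) (\sum_(y <- Y) b' 2 y).
  have : a %% 3 = 1 \/ a %% 3 = 2.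
    have : a %% 3 < 3 by rewrite ltn_mod.
    have : a %% 3 != 0.
      by apply/negP => z; move: co; rewrite coprime_sym prime_coprime // /dvdn z.
    by case: (a %% 3) => [|[|[|//]]] //; [left | right].
  case=> a3.
    have E s : \sum_(y <- Y) b s y = \sum_(y <- Y) b' s y.
      by apply: eq_bigr => y _; rewrite /b /b' -modnMml a3 mul1n.
    by rewrite !E.
  have E s t : s < 3 -> t = (2 * s) %% 3 -> \sum_(y <- Y) b s y = \sum_(y <- Y) b' t y.
    move=> s3 ->; apply: eq_bigr => y _; rewrite /b /b' -modnMml a3 -modnMmr.
    have : (y %/ h) %% 3 < 3 by rewrite ltn_mod.
    by case: ((y %/ h) %% 3) => [|[|[|//]]] _; case: s s3 => [|[|[|//]]].
  by rewrite (E 0 0) // (E 1 2) // (E 2 1) // spread_swap.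
apply: leq_trans (spread_conv _ _ _ _ _ _); rewrite leq_eqVlt; apply/orP; left.
apply/eqP; congr spread.
- have := fun x y (hx : x \in X) (hy : y \in Y) => key x y 0 hx hy isT.
  rewrite mul0n addn0 => k0.
  apply: (count_conv (d := d) (e := b')) => x y xX yY /=; rewrite k0 //.
  by case: (conv_digit (x %/ 3 ^ i) (a * (y %/ h))).
- have := fun x y (hx : x \in X) (hy : y \in Y) => key x y 1 hx hy isT.
  rewrite mul1n => k0.
  apply: (count_conv (d := d) (e := b')) => x y xX yY /=; rewrite k0 //.
  by case: (conv_digit (x %/ 3 ^ i) (a * (y %/ h))).
- apply: (count_conv (d := d) (e := b')) => x y xX yY /=; rewrite key //.
  by case: (conv_digit (x %/ 3 ^ i) (a * (y %/ h))).
Qed.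

(** The contraction on which everything rests: independent summands multiply
their biases. *)
Lemma bias_conv e i a (X Y : seq nat) : coprime a 3 ->
  bias (e + i) [seq 3 ^ e * x + a * y | x <- X, y <- Y] <=
  bias i X * bias (e + i) Y.
Proof.
move=> co; set j := e + i.
have -> : [seq 3 ^ e * x + a * y | x <- X, y <- Y] =
   map (fun z => 3 ^ e * z.1 + a * z.2) [seq (x, y) | x <- X, y <- Y].
  by rewrite map_allpairs.
apply: leq_trans (bias_by_key (k := fun z => z.1 %% 3 ^ i) (N := 3 ^ i) _ _ _) _.
  by apply/allP => z _; rewrite ltn_mod expn_gt0.
rewrite [bias i X]/bias big_distrl; apply: leq_sum => p _.
apply: leq_trans (bias_by_key (k := fun z => z.2 %% 3 ^ j) (N := 3 ^ j) _ _ _) _.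
  by apply/allP => z _; rewrite ltn_mod expn_gt0.
rewrite [bias j Y]/bias big_distrr; apply: leq_sum => q _.
rewrite (allpairs_filter2 (fun x => x %% 3 ^ i == p) (fun y => y %% 3 ^ j == q)).
rewrite map_allpairs /=.
apply: leq_trans (bias_conv_class (p := p) (q := q) _ _ _ _ _) _ => //.
- exact: filter_all.
- exact: filter_all.
apply: eq_leq; congr (_ * _).
  have C s := @residue_count_filter i p s X (ltn_ord p).
  have := (C 0, C 1, C 2); rewrite mul0n mul1n addn0 => -[[-> // -> //] -> //].
have C s := @residue_count_filter j q s Y (ltn_ord q).
by have := (C 0, C 1, C 2); rewrite mul0n mul1n addn0 => -[[-> // -> //] -> //].
Qed.

(** * Parity words and their offsets *)

Definition ones (w : seq bool) : nat := count id w.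

(** The constant term of the affine map that [shortcut] follows along the parity
word w, multiplied by 2 ^ size w; see [parity_orbit]. *)
Fixpoint offset (w : seq bool) : nat :=
  if w is b :: w' then b * 3 ^ ones w' + 2 * offset w' else 0.

Fixpoint words (n : nat) : seq (seq bool) :=
  if n is n'.+1 then map (cons true) (words n') ++ map (cons false) (words n')
  else [:: [::]].

Lemma ones_cat u v : ones (u ++ v) = ones u + ones v.
Proof. exact: count_cat. Qed.

Lemma ones_size w : ones w <= size w.
Proof. exact: count_size. Qed.

Lemma offset_cat u v :
  offset (u ++ v) = 3 ^ ones v * offset u + 2 ^ size u * offset v.
Proof.
elim: u => [|b u IH] /=; first by rewrite muln0 mul1n.
rewrite IH ones_cat expnD expnS; nia.
Qed.

Lemma offset_lt w : offset w < 3 ^ size w.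
Proof.
suff : offset w + 2 ^ size w <= 3 ^ size w.
  have : 0 < 2 ^ size w by rewrite expn_gt0.
  lia.
elim: w => [|b w IH] //=; rewrite !expnS.
have := leq_pexp2l (isT : 0 < 3) (ones_size w).
by case: b; lia.
Qed.

Lemma offset_le w : offset w <= 3 ^ ones w * 2 ^ size w.
Proof.
elim: w => [|b w IH] //=; rewrite expnD !expnS.
have h : 0 < 2 ^ size w by rewrite expn_gt0.
have h3 : 0 < 3 ^ ones w by rewrite expn_gt0.
case: b => /=; rewrite ?expn1 ?expn0; nia.
Qed.

(** The parity of the offset is the first letter, because all terms coming from
later letters are even. *)
Lemma offset_inj u v : size u = size v -> ones u = ones v ->
  offset u = offset v -> u = v.
Proof.
elim: u v => [|b u IH] [|c v] //= [sz] o e.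
have o3 k : odd (3 ^ k) by rewrite oddX orbT.
have bc : b = c.
  have := congr1 odd e; rewrite !mul2n !oddD !odd_double !oddM !o3 !andbT !addbF.
  by case: b {e o}; case: c.
rewrite -{}bc in o e *; have ouv : ones u = ones v by exact: addnI o.
by congr cons; apply: IH => //; rewrite ouv in e; lia.
Qed.

Lemma words_size n w : w \in words n -> size w = n.
Proof.
elim: n w => [|n IH] w /=; first by rewrite inE => /eqP->.
by rewrite mem_cat => /orP[] /mapP[u /IH <- ->].
Qed.

Lemma mem_words w : w \in words (size w).
Proof.
elim: w => //= b w IH; rewrite mem_cat; apply/orP.
by case: b; [left | right]; apply: map_f.
Qed.

Lemma size_words n : size (words n) = 2 ^ n.
Proof. by elim: n => //= n IH; rewrite size_cat !size_map IH addnn expnS mul2n. Qed.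

Lemma uniq_words n : uniq (words n).
Proof.
elim: n => //= n IH; have inj b : injective (cons b : seq bool -> _) by move=> u v [].
rewrite cat_uniq !map_inj_uniq ?IH //= andbT; apply/hasPn => w /mapP [u _ ->].
by apply/negP => /mapP [].
Qed.

Lemma words_cat n1 n2 :
  words (n1 + n2) = [seq u ++ v | u <- words n1, v <- words n2].
Proof.
elim: n1 => [|n IH] /=; first by rewrite cats0 map_id_in.
rewrite allpairs_cat IH !allpairs_mapl.
by congr cat; rewrite map_allpairs.
Qed.

Definition layer (n o : nat) : seq nat :=
  map offset [seq w <- words n | ones w == o].

Definition offset_bias (n j : nat) : nat := bias j (map offset (words n)).

Lemma allpairs_filter_r (T U : Type) (Q : pred U) (X : seq T) (Y : seq U) :
  [seq z <- [seq (x, y) | x <- X, y <- Y] | Q z.2] =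
  [seq (x, y) | x <- X, y <- [seq y <- Y | Q y]].
Proof. by elim: X => //= x X IH; rewrite filter_cat IH filter_map. Qed.

(** The words are sorted by the number o of letters 1 in their suffix of length
n2, which fixes the two multipliers in [offset_cat].  If o exceeds j, the
prefix does not reach level j, and the trivial bound is used. *)
Lemma offset_bias_cat n1 n2 j :
  offset_bias (n1 + n2) j <= \sum_(o < n2.+1)
    (if o <= j then offset_bias n1 (j - o) * bias j (layer n2 o)
     else 2 ^ n1 * size (layer n2 o)).
Proof.
rewrite /offset_bias words_cat.
have -> : map offset [seq u ++ v | u <- words n1, v <- words n2] =
   map (fun z => offset (z.1 ++ z.2)) [seq (u, v) | u <- words n1, v <- words n2].
  by rewrite !map_allpairs.
apply: leq_trans (bias_by_key (k := fun z => ones z.2) (N := n2.+1) _ _ _) _.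
  apply/allP => _ /allpairsP [[u v] /= [_ /words_size vs ->]] /=.
  by rewrite ltnS -vs ones_size.
apply: leq_sum => o _.
rewrite (allpairs_filter_r (fun v => ones v == o)) map_allpairs /=.
have -> : [seq offset (u ++ v) | u <- words n1, v <- [seq v <- words n2 | ones v == o]]
  = [seq 3 ^ o * x + 2 ^ n1 * y | x <- map offset (words n1), y <- layer n2 o].
  rewrite allpairs_mapl allpairs_mapr; apply/eq_in_allpairs => u v.
  rewrite mem_filter => /words_size us /andP[/eqP <- _].
  by rewrite offset_cat us.
case: (leqP o j) => oj.
  rewrite -{1 3}(subnKC oj); apply: leq_trans (bias_conv _ _ _ _ _) _ => //.
  exact: coprimeXl.
apply: leq_trans (bias_size _ _) _.
by rewrite size_allpairs size_map size_words.
Qed.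

Lemma offset_bias_le n j : offset_bias n j <= 2 ^ n.
Proof. by apply: leq_trans (bias_size _ _) _; rewrite size_map size_words. Qed.

Lemma offset_bias_rec n j : offset_bias n.+1 j.+1 <= offset_bias n j.+1 + offset_bias n j.
Proof.
rewrite -addn1; apply: leq_trans (offset_bias_cat n 1 _) _.
rewrite !big_ord_recl big_ord0 /= addn0 subn0 /bump /= subSS subn0.
apply: leq_add; rewrite -[leqRHS]muln1 leq_mul2l; apply/orP; right.
  by apply: leq_trans (bias_size _ _) _.
by apply: leq_trans (bias_size _ _) _.
Qed.

Definition few_ones (n k : nat) : nat := count (fun w => ones w < k) (words n).

Lemma few_ones_rec n k : few_ones n.+1 k.+1 = few_ones n k + few_ones n k.+1.
Proof. by rewrite /few_ones /= count_cat !count_map. Qed.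

(** * A level at which offsets are not determined *)

Definition digit (j x : nat) : nat := (x %/ 3 ^ j) %% 3.

(** A most frequent j-th digit in the class of r modulo 3 ^ j. *)
Definition mode (X : seq nat) (j r : nat) : nat :=
  let a t := residue_count (3 ^ j.+1) X (r + t * 3 ^ j) in
  if (a 1 <= a 0) && (a 2 <= a 0) then 0 else if a 2 <= a 1 then 1 else 2.

Lemma mode_lt3 X j r : mode X j r < 3.
Proof. by rewrite /mode; case: ifP => // _; case: ifP. Qed.

Lemma spread_mode X j r :
  spread (residue_count (3 ^ j.+1) X r) (residue_count (3 ^ j.+1) X (r + 3 ^ j))
         (residue_count (3 ^ j.+1) X (r + 2 * 3 ^ j))
  <= residue_count (3 ^ j.+1) X (r + mode X j r * 3 ^ j).
Proof.
rewrite /mode mul0n mul1n addn0 /spread.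
case: ifP => h; first by rewrite mul0n addn0; lia.
by case: ifP => h'; rewrite ?mul1n; lia.
Qed.

Lemma residue_count_split X j r : (r < 3 ^ j) ->
  residue_count (3 ^ j) X r = (residue_count (3 ^ j.+1) X r + residue_count (3 ^ j.+1) X (r + 3 ^ j)
     + residue_count (3 ^ j.+1) X (r + 2 * 3 ^ j)).
Proof.
move=> rj; have -> : residue_count (3 ^ j) X r = size [seq x <- X | x %% 3 ^ j == r].
  by rewrite size_filter; apply: eq_count => x /=; rewrite (modn_small rj).
rewrite -count_predT; set C := seq.filter _ X.
have C3 t : (t < 3) -> residue_count (3 ^ j.+1) X (r + t * 3 ^ j) = count (fun x => digit j x == t) C.
  move=> t3; rewrite -(residue_count_filter _ rj t3); apply: eq_in_count => x.
  rewrite mem_filter => /andP[/eqP xr _]; exact: digit_eq.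
have := (C3 0 isT, C3 1 isT, C3 2 isT).
rewrite mul0n mul1n addn0 => -[[-> ->] ->].
elim: C {C3} => //= x C ->.
have : (digit j x < 3)by rewrite ltn_mod.
by case: (digit j x) => [|[|[|//]]] _ /=; lia.
Qed.

(** In each class the elements with a minority digit number the size of the
class minus the largest count, and the spread is at most the largest count. *)
Lemma minor_digits X j :
  count (fun x => digit j x != mode X j (x %% 3 ^ j)) X + bias j X <= size X.
Proof.
have kN : all (fun x => x %% 3 ^ j < 3 ^ j) X.
  by apply/allP => x _; rewrite ltn_mod expn_gt0.
rewrite -(count_predT X) !(count_by_key _ kN) /bias -big_split /=.
apply: leq_sum => r _.
set C := [seq x <- X | x %% 3 ^ j == r].
have -> : count (fun x => digit j x != mode X j (x %% 3 ^ j)) C =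
    count (predC (fun x => digit j x == mode X j r)) C.
  by apply: eq_in_count => x; rewrite mem_filter => /andP[/eqP-> _].
rewrite addnC count_predT -(count_predC (fun x => digit j x == mode X j r) C) leq_add2r.
apply: leq_trans (spread_mode _ _ _) _; apply: eq_leq.
rewrite -(residue_count_filter _ (ltn_ord r) (mode_lt3 X j r)) -/C.
apply: eq_in_count => x; rewrite mem_filter => /andP[/eqP xr _].
by rewrite digit_eq // mode_lt3.
Qed.

Lemma digit_low i j r t : i < j -> digit i (r + t * 3 ^ j) = digit i r.
Proof.
move=> ij; rewrite /digit -(subnK ij) addnS expnS expnD.
have -> : r + t * (3 * (3 ^ (j - i.+1) * 3 ^ i)) =
  (t * 3 ^ (j - i.+1) * 3) * 3 ^ i + r by lia.
by rewrite divnMDl ?expn_gt0 // modnMDl.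
Qed.

Lemma digit_top j r t : r < 3 ^ j -> t < 3 -> digit j (r + t * 3 ^ j) = t.
Proof.
move=> rj t3; rewrite /digit addnC divnMDl ?expn_gt0 //.
by rewrite divn_small // addn0 modn_small.
Qed.

Lemma mod_low i j r t : i <= j -> (r + t * 3 ^ j) %% 3 ^ i = r %% 3 ^ i.
Proof.
by move=> ij; rewrite -(subnK ij) expnD mulnA addnC modnMDl.
Qed.

Lemma sum_by_top_digit j (f : nat -> nat) :
  \sum_(x < 3 ^ j.+1) f x =
  \sum_(r < 3 ^ j) (f r + f (r + 1 * 3 ^ j) + f (r + 2 * 3 ^ j)).
Proof.
rewrite expnS; set h := 3 ^ j.
have E c : \sum_(c <= i < c + h) f i = \sum_(i < h) f (i + c).
  by rewrite -{1}[c]add0n big_addn [c + h]addnC addnK big_mkord.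
have h1 : h <= h + h by lia.
have h2 : h + h <= 3 * h by lia.
rewrite -(big_mkord xpredT f) (big_cat_nat (leq0n (h + h)) h2) /=.
rewrite (big_cat_nat (leq0n h) h1) /=.
have -> : 3 * h = (h + h) + h by lia.
rewrite (E h) (E (h + h)) big_mkord -!big_split /=; apply: eq_bigr => r _.
by rewrite mul1n mul2n addnn.
Qed.

(** Guess the digits of x at levels j1, ..., j1 + m - 1 one after the other, mu
predicting each from the lower ones: a hit scores 16 and a miss 1.  Numbers
with few misses get a large weight, and the total weight is small, so only few
numbers are predictable. *)
Definition weight (mu : nat -> nat -> nat) (j1 m x : nat) : nat :=
  \prod_(i < m)
    (if digit (j1 + i) x == mu (j1 + i) (x %% 3 ^ (j1 + i)) then 16 else 1).

(** At each level exactly one of the three digits is a hit: 16 + 1 + 1 = 18. *)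
Lemma sum_weight mu j1 m : (forall j r, mu j r < 3) ->
  \sum_(x < 3 ^ (j1 + m)) weight mu j1 m x = 3 ^ j1 * 18 ^ m.
Proof.
move=> mu3; elim: m => [|m IH].
  rewrite addn0 muln1 (eq_bigr (fun=> 1)) ?sum1_card ?card_ord // => x _.
  by rewrite /weight big_ord0.
rewrite addnS (sum_by_top_digit (j1 + m) (weight mu j1 m.+1)).
rewrite expnS mulnCA -IH big_distrr /=; apply: eq_bigr => r _.
have E t : t < 3 -> weight mu j1 m.+1 (r + t * 3 ^ (j1 + m)) =
   weight mu j1 m r * (if t == mu (j1 + m) r then 16 else 1).
  move=> t3; rewrite /weight big_ord_recr /= digit_top // mod_low // (modn_small (ltn_ord r)).
  congr (_ * _); apply: eq_bigr => i _.
  rewrite mod_low ?digit_low ?ltn_add2l // leq_add2l; exact: ltnW.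
have := E 0; rewrite mul0n addn0 => -> //; rewrite !E //.
have := mu3 (j1 + m) r.
by case: (mu (j1 + m) r) => [|[|[|//]]] _ /=; lia.
Qed.

Lemma weight_errors mu j1 m x :
  weight mu j1 m x * 16 ^ (\sum_(i < m)
     (digit (j1 + i) x != mu (j1 + i) (x %% 3 ^ (j1 + i)))) = 16 ^ m.
Proof.
rewrite /weight expn_sum -big_split /= (eq_bigr (fun=> 16)) ?prod_nat_const ?card_ord //.
by move=> i _; case: (_ == _).
Qed.

(** This is 16 ^ (E - e) >= 1 + (E - e), with e the number of misses of x.  Being
linear in e it can be summed over x, where only the average of e is known. *)
Lemma weight_tangent mu j1 m x E :
  16 ^ m * (1 + E) <= weight mu j1 m x * 16 ^ E + 16 ^ m *
    (\sum_(i < m) (digit (j1 + i) x != mu (j1 + i) (x %% 3 ^ (j1 + i)))).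
Proof.
rewrite -(weight_errors mu j1 m x); set e := \sum_(i < m) _; set W := weight _ _ _ _.
case: (ltnP E e) => Ee.
  by apply: leq_trans (leq_addl _ _); rewrite leq_mul2l add1n Ee orbT.
have : 1 + (E - e) <= 16 ^ (E - e) by rewrite add1n ltn_expl.
have -> : 16 ^ E = 16 ^ e * 16 ^ (E - e) by rewrite -expnD subnKC.
have -> : 1 + E = 1 + (E - e) + e by lia.
by move: (E - e) (16 ^ (E - e)) (16 ^ e) => d D M dD; nia.
Qed.

Lemma sum_seq_le_ord (X : seq nat) N (f : nat -> nat) : uniq X ->
  all (fun x => x < N) X -> \sum_(x <- X) f x <= \sum_(x < N) f x.
Proof.
move=> uX /allP XN; rewrite -(big_mkord xpredT f) /index_iota subn0.
rewrite [leqRHS](bigID (fun x => x \in X)) /= -[Y in _ <= Y + _]big_filter.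
apply: leq_trans (leq_addr _ _); apply: eq_leq; apply: perm_big.
apply: uniq_perm => //; first by rewrite filter_uniq ?iota_uniq.
move=> x; rewrite mem_filter mem_iota /= add0n.
by case: (boolP (x \in X)) => //= /XN ->.
Qed.

(** Words with the same number of letters 1 have distinct offsets below 3 ^ n, so
their weights are part of the total over all numbers below 3 ^ n. *)
Lemma layer_weight n o mu j1 m : (forall j r, mu j r < 3) -> n = j1 + m ->
  \sum_(x <- layer n o) weight mu j1 m x <= 3 ^ j1 * 18 ^ m.
Proof.
move=> mu3 nE; rewrite -(sum_weight j1 m mu3) -nE; apply: sum_seq_le_ord.
  rewrite map_inj_in_uniq ?filter_uniq ?uniq_words // => u v.
  rewrite !mem_filter => /andP[/eqP uo /words_size us] /andP[/eqP vo /words_size vs].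
  by apply: offset_inj; rewrite ?us ?uo.
apply/allP => _ /mapP[w + ->]; rewrite mem_filter => /andP[_ /words_size <-].
exact: offset_lt.
Qed.

(** The bias that remains when the number of letters 1 is known as well. *)
Definition layered_bias n j := \sum_(o < n.+1) bias j (layer n o).

Lemma sum_size_layer n : \sum_(o < n.+1) size (layer n o) = 2 ^ n.
Proof.
rewrite -(size_words n) -(count_predT (words n)).
rewrite (count_by_key (k := ones) (N := n.+1)); last first.
  by apply/allP => w /words_size <-; rewrite ltnS ones_size.
by apply: eq_bigr => o _; rewrite count_predT size_map.
Qed.

(** If the biases were nearly maximal, the most frequent digit would be the right
guess for almost every digit of almost every offset.  Then the 2 ^ n words
would have few misses on average, against the bound on the total weight. *)
Lemma errors_cost n j1 m E : n = j1 + m ->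
  \sum_(i < m) (2 ^ n - layered_bias n (j1 + i)) <= E * 2 ^ n ->
  16 ^ m * 2 ^ n <= (n.+1 * (3 ^ j1 * 18 ^ m)) * 16 ^ E.
Proof.
move=> nE le.
pose mu o := mode (layer n o).
pose e o x := \sum_(i < m) (digit (j1 + i) x != mu o (j1 + i) (x %% 3 ^ (j1 + i))).
have tot : \sum_(o < n.+1) \sum_(x <- layer n o) e o x <= E * 2 ^ n.
  apply: leq_trans le; rewrite /e.
  under eq_bigr => o _ do rewrite exchange_big /=.
  rewrite exchange_big /=; apply: leq_sum => i _.
  rewrite -(sum_size_layer n) leq_subRL.
    rewrite /layered_bias -big_split /=; apply: leq_sum => o _.
    by rewrite addnC -countE; exact: minor_digits.
  by apply: leq_sum => o _; exact: bias_size.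
have cost : 16 ^ m * (1 + E) * 2 ^ n <=
   (\sum_(o < n.+1) \sum_(x <- layer n o) weight (mu o) j1 m x) * 16 ^ E +
   16 ^ m * (\sum_(o < n.+1) \sum_(x <- layer n o) e o x).
  rewrite big_distrl big_distrr -big_split -(sum_size_layer n) big_distrr /=.
  apply: leq_sum => o _; rewrite big_distrl big_distrr -big_split /=.
  rewrite -sum1_size big_distrr /=; apply: leq_sum => x _.
  by rewrite muln1; exact: weight_tangent.
have : \sum_(o < n.+1) \sum_(x <- layer n o) weight (mu o) j1 m x
   <= n.+1 * (3 ^ j1 * 18 ^ m).
  apply: leq_trans (leq_sum _ _) _.
    by move=> o _; apply: (@layer_weight _ _ _ _ _ (fun j r => mode_lt3 _ j r) nE).
  by rewrite sum_nat_const card_ord.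
set A := \sum_(o < _) _ in cost *; set B := \sum_(o < _) _ in tot cost.
move: (3 ^ j1 * 18 ^ m) => C AC.
have : 0 < 16 ^ m by rewrite expn_gt0.
have : A * 16 ^ E <= n.+1 * C * 16 ^ E by rewrite leq_mul2r AC orbT.
move: (n.+1 * C * 16 ^ E) (A * 16 ^ E) cost tot => K L; move: (16 ^ m) (2 ^ n) => M N.
nia.
Qed.

Lemma lin_lt_exp k : 12 <= k -> (200 * k).+1 < 2 ^ k.
Proof.
elim: k => // k IH; rewrite leq_eqVlt => /orP[/eqP <- //|k12].
have := IH k12; rewrite expnS; move: (2 ^ k) => A; lia.
Qed.

(** With n = 200 k, j1 = 110 k, m = 90 k and at most E = k misses on average,
[errors_cost] would give 2 ^ (466 k) <= (n + 1) * 3 ^ (290 k), and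
3 ^ 5 < 2 ^ 8 bounds the right-hand side by (n + 1) * 2 ^ (464 k). *)
Lemma some_unbiased_level k : 12 <= k ->
  exists j, [/\ 110 * k <= j, j < 200 * k &
    90 * layered_bias (200 * k) j <= 89 * 2 ^ (200 * k)].
Proof.
move=> k12; set n := 200 * k.
case: (boolP [exists i : 'I_(90 * k), 90 * layered_bias n (110 * k + i) <= 89 * 2 ^ n]).
  move=> /existsP [i hi]; exists (110 * k + i); split => //.
    exact: leq_addr.
  by have := ltn_ord i; lia.
rewrite negb_exists => /forallP no.
have nE : n = 110 * k + 90 * k by rewrite /n; lia.
have le : \sum_(i < 90 * k) (2 ^ n - layered_bias n (110 * k + i)) <= k * 2 ^ n.
  have : 90 * \sum_(i < 90 * k) (2 ^ n - layered_bias n (110 * k + i))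
     <= \sum_(i < 90 * k) 2 ^ n.
    rewrite big_distrr; apply: leq_sum => i _ /=; have := no i.
    by move: (2 ^ n) (layered_bias _ _) => A B; lia.
  by rewrite sum_nat_const card_ord; lia.
have := errors_cost nE le.
have small : 3 ^ (290 * k) <= 2 ^ (464 * k).
  have -> : 290 * k = 5 * (58 * k) by lia.
  have -> : 464 * k = 8 * (58 * k) by lia.
  by rewrite (expnM 3 5) (expnM 2 8) leq_exp2r //; lia.
have lin : n.+1 < 2 ^ k by exact: lin_lt_exp.
rewrite leqNgt => /negP[].
have -> : 16 ^ (90 * k) * 2 ^ n = 2 ^ (560 * k).
  by rewrite (_ : 16 = 2 ^ 4) // -expnM -expnD; congr expn; rewrite /n; lia.
have -> : n.+1 * (3 ^ (110 * k) * 18 ^ (90 * k)) * 16 ^ k =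
    (n.+1 * 3 ^ (290 * k)) * 2 ^ (94 * k).
  have -> : 18 ^ (90 * k) = 3 ^ (180 * k) * 2 ^ (90 * k).
    by rewrite (_ : 18 = 3 ^ 2 * 2) // expnMn -expnM; congr (_ ^ _ * _); lia.
  have -> : 290 * k = 110 * k + 180 * k by lia.
  have -> : 94 * k = 90 * k + 4 * k by lia.
  by rewrite (expnD 3 (110 * k) (180 * k)) (expnD 2 (90 * k) (4 * k)) (expnM 2 4) -!mulnA.
have -> : 2 ^ (560 * k) = 2 ^ k * 2 ^ (464 * k) * 2 ^ (95 * k).
  by rewrite -!expnD; congr (_ ^ _); lia.
apply: (@leq_trans (2 ^ k * 2 ^ (464 * k) * 2 ^ (94 * k))).
  rewrite ltn_pmul2r ?expn_gt0 //; apply: leq_ltn_trans (leq_mul (leqnn _) small) _.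
  by rewrite ltn_pmul2r ?expn_gt0.
by rewrite leq_mul2l leq_exp2l // leq_mul2r orbT orbT.
Qed.

(** * The shortcut map and its parity words *)

Definition shortcut (m : nat) : nat := if odd m then (3 * m + 1)./2 else m./2.

Fixpoint parity (n m : nat) : seq bool :=
  if n is n'.+1 then odd m :: parity n' (shortcut m) else [::].

Lemma shortcut_double m : 2 * shortcut m = if odd m then 3 * m + 1 else m.
Proof.
rewrite /shortcut; case: ifP => o; rewrite mul2n even_halfK // ?o //.
by rewrite oddD oddM o.
Qed.

Lemma size_parity n m : size (parity n m) = n.
Proof. by elim: n m => //= n IH m; rewrite IH. Qed.

Lemma parity_cat a b m : parity (a + b) m = parity a m ++ parity b (iter a shortcut m).
Proof. by elim: a m => //= a IH m; rewrite IH -iterSr. Qed.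

Lemma parity_orbit n m :
  2 ^ n * iter n shortcut m = 3 ^ ones (parity n m) * m + offset (parity n m).
Proof.
elim: n m => [|n IH] m; first by rewrite /= mul1n addn0.
rewrite iterSr expnS -mulnA IH /= mulnDr mulnCA shortcut_double expnD.
by case: (odd m) => /=; lia.
Qed.

(** Modulo 2 ^ n, [parity_orbit] determines 3 ^ o * m, hence m. *)
Lemma parity_inj n : {in [pred m | m < 2 ^ n] &, injective (parity n)}.
Proof.
move=> m m'; rewrite !inE => mn mn' e.
have := parity_orbit n m; have := parity_orbit n m'; rewrite e.
have : coprime (2 ^ n) (3 ^ ones (parity n m')) by rewrite coprimeXl // coprimeXr.
move: (3 ^ _) (offset _) {e} => a c co h' h.
have E : a * m == a * m' %[mod 2 ^ n] by rewrite -(eqn_modDr c) -h -h' !modnMr.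
wlog le : m m' mn mn' E {h h'} / m <= m' => [W|].
  case: (leqP m m') => [/W|/ltnW /W]; first by apply.
  by rewrite eq_sym => H; apply/esym/H.
move: E; rewrite eq_sym eqn_mod_dvd ?leq_mul2l ?le ?orbT //.
rewrite -mulnBr Gauss_dvdr //; case: (posnP (m' - m)) => [z _|p].
  by apply/eqP; rewrite eqn_leq le -subn_eq0 z.
by rewrite gtnNdvd // (leq_ltn_trans (leq_subr m m')).
Qed.

Lemma perm_parity_words n : perm_eq [seq parity n m | m <- iota 0 (2 ^ n)] (words n).
Proof.
have u : uniq [seq parity n m | m <- iota 0 (2 ^ n)].
  rewrite map_inj_in_uniq ?iota_uniq // => m m'.
  by rewrite !mem_iota !add0n => mn mn'; apply: parity_inj.
apply: uniq_perm => //; first exact: uniq_words.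
have sub : {subset [seq parity n m | m <- iota 0 (2 ^ n)] <= words n}.
  by move=> _ /mapP[m _ ->]; rewrite -{2}(size_parity n m) mem_words.
have := uniq_min_size u sub.
by rewrite size_map size_iota size_words leqnn => /(_ isT) [].
Qed.

Lemma count_parity s n (P : pred (seq bool)) : s <= n ->
  count (fun m => P (parity s m)) (iota 0 (2 ^ n)) = 2 ^ (n - s) * count P (words s).
Proof.
move=> sn; have E m : parity s m = take s (parity n m).
  by rewrite -{1}(subnKC sn) parity_cat take_size_cat ?size_parity.
under eq_count => m do rewrite E.
rewrite -(count_map (parity n) (fun w => P (take s w))).
rewrite (permP (perm_parity_words n)) -{1}(subnKC sn) words_cat.
have : all (fun u => size u == s) (words s).
  by apply/allP => u /words_size ->.
rewrite -(size_words (n - s)) mulnC.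
elim: (words s) => [|u U IH] //=; move=> /andP[/eqP us /IH {}IH].
rewrite count_cat IH mulnDl; congr addn.
rewrite count_map -(@eq_count _ (fun=> P u)); last by move=> v /=; rewrite take_size_cat.
by case: (P u); rewrite ?mul1n ?mul0n ?count_predT ?count_pred0.
Qed.

(** y is the image of a natural number under the affine map of w.  Such a number
is at most 2 ^ size w * y, which makes the condition decidable. *)
Definition leads (w : seq bool) (y : nat) : bool :=
  [exists m : 'I_(2 ^ size w * y).+1,
     3 ^ ones w * m + offset w == 2 ^ size w * y].

Lemma leadsP w y :
  reflect (exists m, 3 ^ ones w * m + offset w = 2 ^ size w * y) (leads w y).
Proof.
apply: (iffP existsP) => [[m /eqP h]|[m h]]; first by exists m.
have mlt : m < (2 ^ size w * y).+1.
  rewrite -h ltnS; apply: leq_trans (leq_addr _ _).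
  by rewrite leq_pmull // expn_gt0.
by exists (Ordinal mlt); rewrite /= h.
Qed.

Lemma leads_parity n m : leads (parity n m) (iter n shortcut m).
Proof. by apply/leadsP; exists m; rewrite size_parity parity_orbit. Qed.

Definition pullback (v : seq bool) (y : nat) : nat :=
  (2 ^ size v * y - offset v) %/ 3 ^ ones v.

(** The value reached after u is an integer because 2 ^ |u| is coprime to
3 ^ ones v, and y and v determine it. *)
Lemma leads_cat u v y : leads (u ++ v) y -> leads v y && leads u (pullback v y).
Proof.
case/leadsP => m; rewrite ones_cat offset_cat size_cat !expnD.
set a := 3 ^ ones u; set b := 3 ^ ones v; set p := 2 ^ size u; set q := 2 ^ size v.
move=> e; have e' : b * (a * m + offset u) + p * offset v = p * (q * y) by lia.
have : p %| b * (a * m + offset u).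
  by rewrite -(dvdn_addl _ (dvdn_mulr (offset v) (dvdnn p))) e' dvdn_mulr.
rewrite Gauss_dvdr ?coprimeXl ?coprimeXr // => /dvdnP [z ez].
have p0 : 0 < p by rewrite expn_gt0.
have b0 : 0 < b by rewrite expn_gt0.
have vz : b * z + offset v = q * y.
  apply/eqP; rewrite -(eqn_pmul2l p0) -e' ez; apply/eqP; lia.
apply/andP; split; first by apply/leadsP; exists z.
have -> : pullback v y = z by rewrite /pullback -/q -vz addnK mulKn.
by apply/leadsP; exists m; rewrite ez mulnC.
Qed.

(** The parity word and the image determine m by [parity_orbit]. *)
Lemma fiber_le_words n N y (P : pred (seq bool)) :
  count (fun m => (iter n shortcut m == y) && P (parity n m)) (iota 0 N) <=
  count (fun w => leads w y && P w) (words n).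
Proof.
rewrite -!size_filter -(size_map (parity n)); apply: uniq_leq_size.
  rewrite map_inj_in_uniq ?filter_uniq ?iota_uniq // => m m'.
  rewrite !mem_filter => /andP[/andP[/eqP h _] _] /andP[/andP[/eqP h' _] _] e.
  have := parity_orbit n m'; rewrite -e h' -h parity_orbit => /eqP.
  by rewrite eqn_add2r eqn_pmul2l ?expn_gt0 // => /eqP.
move=> _ /mapP[m + ->]; rewrite !mem_filter => /andP[/andP[/eqP <- ->] _].
by rewrite leads_parity -{2}(size_parity n m) mem_words.
Qed.

Definition bad_count (bad : pred (seq bool)) (p K : nat) (w : seq bool) : nat :=
  \sum_(i < K) bad (take p (drop (i * p) w)).

Lemma bad_count_cat bad p K u v : size u = K * p -> size v = p ->
  bad_count bad p K.+1 (u ++ v) = bad_count bad p K u + bad v.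
Proof.
move=> us vs; rewrite /bad_count big_ord_recr /=; congr addn; last first.
  by rewrite drop_size_cat // take_oversize // vs.
apply: eq_bigr => i _; congr (nat_of_bool (bad _)).
have ip : i * p + p <= K * p by rewrite -mulSnr leq_mul2r ltn_ord orbT.
rewrite drop_cat us; case: ltnP => h.
  by rewrite takel_cat // size_drop us leq_subRL // ltnW.
have -> : p = 0 by lia.
by rewrite !take0.
Qed.

Local Open Scope classical_set_scope.
Local Open Scope ring_scope.

(** * Large deviations for the number of ones *)

Lemma near_linear (R : realType) (c C : R) : 0 < c ->
  \forall n \near \oo, C <= c * n%:R.
Proof.
move=> c0; near=> n; rewrite mulrC -ler_pdivrMr //.
near: n; exact: nbhs_infty_ger.
Unshelve. all: by end_near. Qed.

Lemma near_exp_small (R : realType) (c e : R) : 0 < c -> 0 < e ->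
  \forall n \near \oo, expR (- (c * n%:R)) <= e.
Proof.
move=> c0 e0; near=> n; rewrite expRN invf_ple ?posrE ?expR_gt0 //.
apply: le_trans (expR_ge1Dx _); rewrite addrC -lerBlDr.
near: n; exact: near_linear.
Unshelve. all: by end_near. Qed.

(** From exp (- s) >= 1 - s the left-hand side is at most 2 / (1 - s ^ 2), while
exp (2 s ^ 2) >= 1 + 2 s ^ 2. *)
Lemma cosh_bound (R : realType) (s : R) : `|s| <= 2^-1 ->
  expR s + expR (- s) <= 2 * expR (2 * s ^+ 2).
Proof.
rewrite ler_norml => /andP[s1 s2].
have a : expR s <= (1 - s)^-1.
  rewrite -[expR s]invrK -expRN lef_pV2 ?posrE ?expR_gt0 //; last by lra.
  exact: expR_ge1Dx.
have b : expR (- s) <= (1 + s)^-1.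
  rewrite expRN lef_pV2 ?posrE ?expR_gt0 //; last by lra.
  exact: expR_ge1Dx.
apply: le_trans (lerD a b) _.
have -> : (1 - s)^-1 + (1 + s)^-1 = 2 * (1 - s ^+ 2)^-1.
  have h1 : 1 - s != 0 by rewrite lt0r_neq0 //; lra.
  have h2 : 1 + s != 0 by rewrite lt0r_neq0 //; lra.
  have h3 : 1 - s ^+ 2 != 0 by rewrite lt0r_neq0 //; nra.
  by field; rewrite h1 h2 h3.
rewrite ler_pM2l //; apply: le_trans (expR_ge1Dx _).
have t0 : 0 <= s ^+ 2 by exact: sqr_ge0.
have t1 : s ^+ 2 <= 4^-1 by nra.
move: (s ^+ 2) t0 t1 => t t0 t1; rewrite -[leLHS]mul1r ler_pdivrMr; nra.
Qed.

Lemma words_moment (R : realType) (s : R) n :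
  \sum_(w <- words n) expR (s * (2 * (ones w)%:R - n%:R)) =
  (expR s + expR (- s)) ^+ n.
Proof.
elim: n => [|n IH].
  by rewrite /= big_seq1 expr0 /ones /= mulr0 subr0 mulr0 expR0.
rewrite /= big_cat !big_map /= exprS -IH mulrDl !mulr_sumr.
congr (_ + _); apply: eq_bigr => w _; rewrite -expRD; congr expR.
  by rewrite /ones /= natrD -natr1; ring.
by rewrite /ones /= natrD -natr1; ring.
Qed.

Lemma count_le_sum (R : realType) (T : Type) (P : pred T) (f : T -> R) s :
  (forall x, 0 <= f x) -> (forall x, P x -> 1 <= f x) ->
  (count P s)%:R <= \sum_(x <- s) f x.
Proof.
move=> f0 f1; rewrite countE natr_sum; apply: ler_sum => x _.
by case: (boolP (P x)) => // /f1.
Qed.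

(** Exponential Markov inequality with parameter th / 4.  Lengths n <= N with a
threshold in terms of N allow a union bound over all prefixes. *)
Lemma deviating_words (R : realType) (th : R) (n N : nat) : 0 < th -> th <= 1 ->
  (n <= N)%N ->
  (count (fun w => th * N%:R < `|2 * (ones w)%:R - n%:R|) (words n))%:R
    <= 2 * 2 ^+ n * expR (- (th ^+ 2 / 8 * N%:R)).
Proof.
move=> th0 th1 nN.
pose s := th / 4.
have M (e : R) : `|e| <= 2^-1 -> (expR e + expR (- e)) ^+ n <=
    2 ^+ n * expR (2 * e ^+ 2 * N%:R).
  move=> he; apply: le_trans (lerXn2r _ _ _ (cosh_bound he)) _.
  - by rewrite nnegrE addr_ge0 ?expR_ge0.
  - by rewrite nnegrE mulr_ge0 ?expR_ge0.
  rewrite exprMn ler_pM2l ?exprn_gt0 // -expRM_natr ler_expR.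
  by rewrite ler_wpM2l ?ler_nat // mulr_ge0 // sqr_ge0.
have sb : `|s| <= 2^-1 by rewrite ger0_norm /s; lra.
have P1 := M _ sb; have P2 := M (- s).
rewrite normrN in P2; have {}P2 := P2 sb.
rewrite -!words_moment in P1 P2.
apply: (@le_trans _ _ (\sum_(w <- words n)
   expR (- (s * th * N%:R)) * (expR (s * (2 * (ones w)%:R - n%:R)) +
     expR (- s * (2 * (ones w)%:R - n%:R))))).
  apply: count_le_sum => w.
    by rewrite mulr_ge0 ?addr_ge0 ?expR_ge0.
  move=> h; rewrite mulrDr -!expRD.
  have [d0|d0] := leP 0 (2 * (ones w)%:R - n%:R : R).
    rewrite ger0_norm // in h.
    apply: (@le_trans _ _ (expR (- (s * th * N%:R) + s * (2 * (ones w)%:R - n%:R)))).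
      by rewrite -{1}expR0 ler_expR /s; nra.
    by rewrite lerDl expR_ge0.
  rewrite ltr0_norm // in h.
  apply: (@le_trans _ _ (expR (- (s * th * N%:R) + - s * (2 * (ones w)%:R - n%:R)))).
    by rewrite -{1}expR0 ler_expR /s; nra.
  by rewrite lerDr expR_ge0.
rewrite -mulr_sumr big_split /=.
apply: le_trans (ler_wpM2l (expR_ge0 _) (lerD P1 P2)) _.
rewrite sqrrN; set A := expR _; set B := expR _; set C := 2 ^+ n.
have -> : A * (C * B + C * B) = 2 * C * (A * B) by ring.
rewrite ler_pM2l ?mulr_gt0 ?exprn_gt0 // -expRD ler_expR /s.
by rewrite le_eqVlt; apply/orP; left; apply/eqP; field.
Qed.

(** * The bias tends to zero *)

Lemma few_ones_mono n k k' : (k <= k')%N -> (few_ones n k <= few_ones n k')%N.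
Proof. by move=> kk; apply: sub_count => w /= /leq_trans; apply. Qed.

Lemma few_ones_small (R : realType) (th : R) (n k : nat) : 0 < th -> th <= 1 ->
  2 * k%:R <= (1 - th) * n%:R ->
  (few_ones n k)%:R <= 2 * 2 ^+ n * expR (- (th ^+ 2 / 8 * n%:R)).
Proof.
move=> th0 th1 kn; apply: le_trans _ (deviating_words th0 th1 (leqnn n)).
rewrite ler_nat; apply: sub_count => w /= ow.
rewrite ltr_normr; apply/orP; right.
have : (ones w)%:R + 1 <= k%:R :> R by rewrite natr1 ler_nat.
lra.
Qed.

Lemma many_ones_small (R : realType) (th : R) (n k : nat) : 0 < th -> th <= 1 ->
  (1 + th) * n%:R <= 2 * k%:R ->
  (count (fun w => k < ones w)%N (words n))%:R <=
  2 * 2 ^+ n * expR (- (th ^+ 2 / 8 * n%:R)).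
Proof.
move=> th0 th1 kn; apply: le_trans _ (deviating_words th0 th1 (leqnn n)).
rewrite ler_nat; apply: sub_count => w /= ow.
rewrite ltr_normr; apply/orP; left.
have : k%:R + 1 <= (ones w)%:R :> R by rewrite natr1 ler_nat.
lra.
Qed.

Lemma near_few (R : realType) (k : nat) (e : R) : 0 < e ->
  \forall n \near \oo, (few_ones n k)%:R <= e * 2 ^+ n.
Proof.
move=> e0; near=> n.
apply: le_trans (few_ones_small (th := 2^-1) _ _ _) _; [lra | lra | | ].
  rewrite (_ : 1 - 2^-1 = 2^-1 :> R); last by field.
  by near: n; apply: near_linear.
rewrite mulrAC ler_pM2r ?exprn_gt0 //.
rewrite -ler_pdivlMl //; near: n; apply: near_exp_small; first by lra.
by rewrite mulr_gt0.
Unshelve. all: by end_near. Qed.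

(** Reading a word backwards, the first k letters 1 that are met lower the level
from J + k to J; only words with fewer than k ones among i letters escape.
The induction on i is Pascal's rule, by [offset_bias_rec] and
[few_ones_rec]. *)
Lemma offset_bias_propagate (R : realType) (x : R) n0 i J k :
  (forall n, (n0 <= n)%N -> (offset_bias n J)%:R <= x * 2 ^+ n) ->
  (offset_bias (n0 + i) (J + k))%:R <= x * 2 ^+ (n0 + i) + 2 ^+ n0 * (few_ones i k)%:R.
Proof.
move=> GJ; have x2 n : 0 <= x * 2 ^+ n.
  have : 0 <= x * 2 ^+ n0 by apply: le_trans (GJ _ (leqnn n0)).
  by rewrite pmulr_lge0 ?exprn_gt0 // => x0; rewrite mulr_ge0 ?exprn_ge0.
elim: i k => [|i IH] [|k].
- by rewrite !addn0; apply: le_trans (GJ _ _) _; rewrite ?lerDl ?mulr_ge0 ?exprn_ge0.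
- rewrite addn0 /few_ones /= mulr1; apply: (@le_trans _ _ (2 ^+ n0)).
    by rewrite -natrX ler_nat offset_bias_le.
  by rewrite lerDr.
- rewrite addn0; apply: le_trans (GJ _ _) _; rewrite ?leq_addr //.
  by rewrite ?lerDl ?mulr_ge0 ?exprn_ge0.
rewrite !addnS few_ones_rec natrD exprS.
have : (offset_bias (n0 + i).+1 (J + k).+1)%:R <= (offset_bias (n0 + i) (J + k).+1)%:R + (offset_bias (n0 + i) (J + k))%:R :> R.
  by rewrite -natrD ler_nat offset_bias_rec.
have := IH k; have := IH k.+1; rewrite addnS; lra.
Qed.

(** Low bias at one level J, for all long words; by [low_bias_above] the level
can then be raised at will. *)
Definition low_bias (R : realType) (x : R) : Prop :=
  exists J, \forall n \near \oo, (offset_bias n J)%:R <= x * 2 ^+ n.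

Lemma low_bias_above (R : realType) (x : R) J D : 0 < x ->
  (\forall n \near \oo, (offset_bias n J)%:R <= x * 2 ^+ n) ->
  forall e, 0 < e ->
  \forall n \near \oo, forall k, (k <= D)%N ->
    (offset_bias n (J + k))%:R <= (x + e) * 2 ^+ n.
Proof.
move=> x0 [n0 _ Gn0] e e0.
have [i0 _ Fi0] := near_few D e0.
near=> n => k kD.
have n0n : (n0 + i0 <= n)%N by near: n; exact: nbhs_infty_ge.
have [i -> i0i] : exists2 i, n = (n0 + i)%N & (i0 <= i)%N.
  by exists (n - n0)%N; lia.
apply: le_trans (offset_bias_propagate _ _ _ (x := x)) _; first exact: Gn0.
rewrite mulrDl lerD2l exprD mulrCA ler_pM2l ?exprn_gt0 //.
apply: le_trans _ (Fi0 _ i0i); rewrite ler_nat; exact: few_ones_mono.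
Unshelve. all: by end_near. Qed.

(** Append a suffix of length n2 = 200 k at a level j where its own bias is at
most 89 / 90.  As j >= 110 k, most suffixes leave at least J levels to the
prefix, whose bias is at most x + e there; the remaining suffixes are
negligible.  The loss e = x / 400 keeps the product below 179 / 180 x. *)
Lemma low_bias_step (R : realType) (x : R) : 0 < x ->
  low_bias x -> low_bias (179 / 180 * x).
Proof.
move=> x0 [J GJ]; pose e := x / 400.
have e0 : 0 < e by rewrite /e; lra.
have c0 : 0 < 20^-1 ^+ 2 / 8 * 200%:R :> R by lra.
have es := near_exp_small c0 (mulr_gt0 (_ : 0 < 2^-1) e0).
have {}es := es ltac:(by lra).
have [k [k12 kJ kmany]] : exists k, [/\ (12 <= k)%N, (J <= 5 * k)%N &
    2 * expR (- (20^-1 ^+ 2 / 8 * (200 * k)%:R)) <= e :> R].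
  have : \forall k \near \oo, [/\ (12 <= k)%N, (J <= 5 * k)%N &
    2 * expR (- (20^-1 ^+ 2 / 8 * (200 * k)%:R)) <= e :> R].
    near=> k; split.
    - by near: k; exact: nbhs_infty_ge.
    - have : (J <= k)%N by near: k; exact: nbhs_infty_ge.
      by lia.
    by rewrite natrM mulrA -ler_pdivlMl //; near: k.
  by move=> [N _ /(_ N (leqnn N))] h; exists N.
(* k is so large that j - J >= 105 k, beyond the typical 100 k ones. *)
have [j [jlo jhi low]] := some_unbiased_level k12.
set n2 := (200 * k)%N in low kmany jhi.
have [n0 _ Gn0] := low_bias_above j x0 GJ e0.
exists j; near=> n.
have n0n : (n0 + n2 <= n)%N by near: n; exact: nbhs_infty_ge.
have [n1 -> {n0n}n01] : exists2 n1, n = (n1 + n2)%N & (n0 <= n1)%N.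
  by exists (n - n2)%N; lia.
have lowR : 90 * (layered_bias n2 j)%:R <= 89 * 2 ^+ n2 :> R.
  by rewrite -natrX -!natrM ler_nat.
have many : (count (fun w => j - J < ones w)%N (words n2))%:R <= e * 2 ^+ n2 :> R.
  apply: le_trans (many_ones_small (th := 20^-1) _ _ _) _; [lra | lra | | ].
    have a : (105 * k + J <= j)%N by lia.
    have : (105 * k)%:R <= (j - J)%:R :> R by rewrite ler_nat; lia.
    by rewrite /n2 !natrM; lra.
  by rewrite mulrAC ler_pM2r ?exprn_gt0.
apply: (@le_trans _ _ ((x + e) * 2 ^+ n1 * (layered_bias n2 j)%:R +
   2 ^+ n1 * (count (fun w => j - J < ones w)%N (words n2))%:R)); last first.
  rewrite exprD; set A := 2 ^+ n1; set B := 2 ^+ n2.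
  set u := _%:R; set v := _%:R.
  have -> : (x + e) * A * u + A * v = A * ((x + e) * u + v) by ring.
  rewrite [leRHS]mulrCA ler_pM2l ?exprn_gt0 //.
  have : (x + e) * (90 * (layered_bias n2 j)%:R) <= (x + e) * (89 * 2 ^+ n2).
    by rewrite ler_wpM2l // addr_ge0 // ltW.
  have := exprn_gt0 n2 (ltr0n R 2); have := many.
  rewrite -/B -/u -/v /e; nra.
have -> : count (fun w => j - J < ones w)%N (words n2) =
    (\sum_(o < n2.+1) (j - J < o)%N * size (layer n2 o))%N.
  rewrite (count_by_key (k := ones) (N := n2.+1)); last first.
    by apply/allP => w /words_size <-; rewrite ltnS ones_size.
  apply: eq_bigr => o _; rewrite /layer size_map -count_predT mulnC.
  rewrite -(@eq_in_count _ (fun=> (j - J < o)%N)); last first.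
    by move=> w; rewrite mem_filter => /andP[/eqP-> _].
  by case: (_ < o)%N; rewrite ?muln1 ?muln0 //; elim: [seq _ <- _ | _].
apply: (@le_trans _ _ (\sum_(o < n2.+1) ((if o <= j then offset_bias n1 (j - o) * bias j (layer n2 o)
     else 2 ^ n1 * size (layer n2 o))%N)%:R)).
  by rewrite -natr_sum ler_nat offset_bias_cat.
rewrite /layered_bias !natr_sum !mulr_sumr -big_split /=.
apply: ler_sum => o _.
case: (ltnP (j - J) o) => oj; last first.
  rewrite mul0n mulr0 addr0; have -> : (o <= j)%N by lia.
  rewrite natrM ler_wpM2r //.
  have -> : (j - o = J + (j - o - J))%N by lia.
  by apply: (Gn0 n1 n01); lia.
rewrite mul1n; case: leqP => oj'; rewrite natrM; last first.
  by rewrite natrX lerDr !mulr_ge0 ?exprn_ge0 // addr_ge0 // ltW.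
apply: (@le_trans _ _ (2 ^+ n1 * (size (layer n2 o))%:R)).
  by rewrite ler_pM ?ler_nat ?bias_size // -natrX ler_nat offset_bias_le.
by rewrite lerDr !mulr_ge0 ?exprn_ge0 // addr_ge0 // ltW.
Unshelve. all: by end_near. Qed.

Lemma low_bias_all (R : realType) (x : R) : 0 < x -> low_bias x.
Proof.
move=> x0; have step n : low_bias ((179 / 180) ^+ n : R).
  elim: n => [|n IH]; last by rewrite exprS; apply: low_bias_step IH; apply: exprn_gt0; lra.
  exists 0%N; near=> n; rewrite expr0 mul1r -natrX ler_nat; exact: offset_bias_le.
have c0 : 0 < 180^-1 :> R by lra.
have [N _ /(_ N (leqnn N)) /= small] := near_exp_small c0 x0.
have le : (179 / 180) ^+ N <= x :> R.
  apply: le_trans _ small; rewrite -mulNr expRM_natr lerXn2r ?nnegrE ?expR_ge0 //.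
  by apply: le_trans (expR_ge1Dx _); lra.
have [J GJ] := step N; exists J.
move: GJ; apply: filterS => n h; apply: le_trans h _.
by rewrite ler_wpM2r ?exprn_ge0.
Unshelve. all: by end_near. Qed.

(** * Most blocks share their residue with few others *)

(** The digit of x at level j is noticeably more frequent than 1 / 3 in the class
of x. *)
Definition heavy (R : realType) (lam : R) (X : seq nat) (j x : nat) : bool :=
  (1 + lam) * (residue_count (3 ^ j) X x)%:R < 3 * (residue_count (3 ^ j.+1) X x)%:R.

(** A class with a heavy digit has spread at least lam / 3 times its size. *)
Lemma heavy_count (R : realType) (lam : R) X j : 0 < lam ->
  lam * (count (heavy lam X j) X)%:R <= 3 * (bias j X)%:R.
Proof.
move=> l0.
have kN : all (fun x => x %% 3 ^ j < 3 ^ j)%N X.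
  by apply/allP => x _; rewrite ltn_mod expn_gt0.
rewrite (count_by_key _ kN) /bias !natr_sum !mulr_sumr; apply: ler_sum => r _.
set C := seq.filter _ X; set a := residue_count _ X r; set b := residue_count _ X _; set c := residue_count _ X _.
have szC : size C = (a + b + c)%N.
  rewrite -(residue_count_split X (ltn_ord r)) size_filter; apply: eq_count => x /=.
  by rewrite (modn_small (ltn_ord r)).
have [hC|] := boolP (has (heavy lam X j) C); last first.
  by rewrite has_count -leqNgt leqn0 => /eqP ->; rewrite mulr0 mulr_ge0.
have le : (count (heavy lam X j) C)%:R <= (a + b + c)%:R :> R.
  by rewrite ler_nat -szC count_size.
move: hC => /hasP [x]; rewrite mem_filter => /andP[/eqP xr xX].
rewrite /heavy (@residue_count_mod _ _ x r); last by rewrite -xr modn_mod.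
have -> : residue_count (3 ^ j) X r = (a + b + c)%N by rewrite (residue_count_split X (ltn_ord r)).
have : [|| residue_count (3 ^ j.+1) X x == a, residue_count (3 ^ j.+1) X x == b | residue_count (3 ^ j.+1) X x == c].
  have d3 : (digit j x < 3)%N by rewrite ltn_mod.
  have -> : residue_count (3 ^ j.+1) X x = residue_count (3 ^ j.+1) X (r + digit j x * 3 ^ j).
    by apply: residue_count_mod; apply/eqP; rewrite digit_eq.
  case: (digit j x) d3 => [|[|[|//]]] _; rewrite ?mul0n ?addn0 ?mul1n -/a -/b -/c.
  - by rewrite eqxx.
  - by rewrite eqxx orbT.
  - by rewrite eqxx !orbT.
move: (residue_count _ X x) => d dabc hd.
have sp : d%:R * 3 <= (a + b + c)%:R + 3 * (spread a b c)%:R :> R.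
  by rewrite -!natrM -natrD ler_nat /spread; lia.
nra.
Qed.

Lemma ler_congr (R : numDomainType) (a b c d : R) :
  c = a -> b = d -> a <= b -> c <= d.
Proof. by move=> -> ->. Qed.

(** Each new digit divides the class of x by almost 3, except at heavy levels,
where the class may stay the same. *)
Lemma residue_count_chain (R : realType) (lam : R) X J m x : 0 < lam ->
  (residue_count (3 ^ (J + m)) X x)%:R * 3 ^+ m <=
  (residue_count (3 ^ J) X x)%:R * (1 + lam) ^+ m *
    3 ^+ (\sum_(i < m) heavy lam X (J + i) x)%N.
Proof.
move=> l0; elim: m => [|m IH]; first by rewrite addn0 big_ord0 !expr0 !mulr1.
rewrite big_ord_recr /= exprD addnS.
have l1 : 0 <= 1 + lam by lra.
have step : (residue_count (3 ^ (J + m).+1) X x)%:R * 3 <=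
    (residue_count (3 ^ (J + m)) X x)%:R * (1 + lam) * 3 ^+ heavy lam X (J + m) x.
  case: (boolP (heavy lam X (J + m) x)) => /= h.
    rewrite expr1 ler_wpM2r // -[leLHS]mulr1 ler_pM // ?lerDl //; last by lra.
    rewrite ler_nat; apply: sub_count => y /= /eqP/(congr1 (modn ^~ (3 ^ (J + m)))%N).
    by rewrite !modn_dvdm ?dvdn_exp2l // => ->.
  by rewrite expr0 mulr1; move: h; rewrite /heavy -leNgt; lra.
move: (\sum_(i < m) _)%N IH step => e IH step.
move: (nat_of_bool (heavy _ _ _ _)) step => h step.
apply: (@le_trans _ _ ((residue_count (3 ^ (J + m)) X x)%:R * 3 ^+ m * ((1 + lam) * 3 ^+ h))).
  have := ler_wpM2r (exprn_ge0 m (ler0n R 3)) step.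
  by apply: ler_congr; rewrite ?exprS; ring.
have W0 : 0 <= (1 + lam) * 3 ^+ h by rewrite mulr_ge0 // exprn_ge0.
have := ler_wpM2r W0 IH.
by apply: ler_congr; rewrite ?exprS; ring.
Qed.

(** This is 2 ^ p / 3 ^ (p / 2) up to the factor exp (eps * p). *)
Definition block_bound (R : realType) (eps : R) (p : nat) : R :=
  expR (p%:R * (ln 2 - ln 3 / 2 + eps)).

(** A block is good if it has at least J odd steps, so that its offset is known
modulo 3 ^ J from the image, and at most B blocks share that residue. *)
Definition bad_block (R : realType) (B : R) (p J : nat) (v : seq bool) : bool :=
  ~~ ((J <= ones v)%N &&
      ((residue_count (3 ^ J) (map offset (words p)) (offset v))%:R <= B)).

Lemma ln3_lt2 (R : realType) : ln 3 <= 2 :> R.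
Proof.
have := le_ln1Dx (_ : -1 < (2 : R)); rewrite (_ : 1 + 2 = 3) //; apply; lra.
Qed.

Lemma ln3_gt0 (R : realType) : 0 < ln 3 :> R.
Proof. by apply: ln_gt0; lra. Qed.

Lemma expR_ln_nat (R : realType) (n k : nat) : (0 < n)%N ->
  expR (k%:R * ln n%:R) = n%:R ^+ k :> R.
Proof. by move=> n0; rewrite mulrC expRM_natr lnK // posrE ltr0n. Qed.

(** The level J is D, slightly below p / 2.  A block with at least D ones is bad
only if it is heavy at more than lam * p levels.  The biases at the levels
between the starting level of [low_bias] and D are at most 2 x * 2 ^ p, so on average
few levels are heavy, and Markov's inequality applies. *)
Lemma most_blocks_good (R : realType) (eps : R) (L : nat) : 0 < eps -> eps <= 1 ->
  exists p J, [/\ (L <= p)%N, (0 < p)%N &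
    (count (bad_block (block_bound eps p) p J) (words p))%:R <= eps * 2 ^+ p].
Proof.
move=> e0 e1.
pose lam := eps / 8.
have l0 : 0 < lam by rewrite /lam; lra.
pose x := eps * lam * lam / 6.
have x0 : 0 < x by rewrite /x !mulr_gt0 //; lra.
have [J GJ] := low_bias_all x0.
have [n0 _ Gn0] := GJ.
have c0 : 0 < (lam / 2) ^+ 2 / 8 by rewrite divr_gt0 ?exprn_gt0 //; lra.
have fs := near_exp_small c0 (mulr_gt0 (_ : 0 < 2^-1) x0).
have {}fs := fs ltac:(by lra); have [i0 _ {}fs] := fs.
have fs' := near_exp_small c0 (mulr_gt0 (_ : 0 < 4^-1) e0).
have {}fs' := fs' ltac:(by lra); have [i1 _ {}fs'] := fs'.
have l8 : 0 < eps / 4 by lra.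
have lin := @near_linear R (eps / 4) (2 * (1 + J%:R)) l8.
have lin2 := @near_linear R (lam / 2) n0%:R (_ : 0 < lam / 2).
have {}lin2 := lin2 ltac:(by lra).
have [p [[Lp p0 pi0 pi1] [p1 p2]]] : exists p, [/\ (L <= p)%N, (0 < p)%N,
   (n0 + i0 <= p)%N & (i1 <= p)%N] /\
   (2 * (1 + J%:R) <= eps / 4 * p%:R /\ n0%:R <= lam / 2 * p%:R).
  have : \forall p \near \oo, [/\ (L <= p)%N, (0 < p)%N,
   (n0 + i0 <= p)%N & (i1 <= p)%N] /\
   (2 * (1 + J%:R) <= eps / 4 * p%:R /\ n0%:R <= lam / 2 * p%:R).
    near=> p; split; split.
    - by near: p; exact: nbhs_infty_ge.
    - by near: p; exact: nbhs_infty_ge.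
    - by near: p; exact: nbhs_infty_ge.
    - by near: p; exact: nbhs_infty_ge.
    - by near: p.
    - by near: p.
  by move=> [N _ /(_ N (leqnn N))] h; exists N.
have lam8 : lam <= 8^-1 by rewrite /lam; lra.
have pR : 0 < p%:R :> R by rewrite ltr0n.
have lp : 0 < lam * p%:R by rewrite mulr_gt0.
have [D [Dlo Dhi]] : exists D : nat, D%:R <= (1 - lam) * p%:R / 2 /\
    (1 - lam) * p%:R / 2 - 1 < D%:R.
  have D0 : 0 <= (1 - lam) * p%:R / 2 by rewrite !mulr_ge0 // ?ltW //; lra.
  exists (Num.truncn ((1 - lam) * p%:R / 2)).
  by have /andP[-> Dhi] := truncn_itv D0; rewrite ltrBlDr natr1.
exists p, D; split => //.
set X := map offset (words p).
have JD : (J <= D)%N.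
  rewrite -(ler_nat R); apply: ltW; apply: le_lt_trans Dhi.
  rewrite lerBrDr; have : eps / 4 * p%:R <= 4^-1 * p%:R by rewrite ler_pM2r //; lra.
  have : lam * p%:R <= 8^-1 * p%:R by rewrite ler_pM2r.
  lra.
pose h v := (\sum_(i < D - J) heavy lam X (J + i) (offset v))%N.
have tail (n : nat) : (n <= p)%N -> 2 * D%:R <= (1 - lam / 2) * n%:R ->
    (few_ones n D)%:R <= 2 * 2 ^+ n * expR (- ((lam / 2) ^+ 2 / 8 * n%:R)).
  by move=> np hn; apply: few_ones_small => //; clear -l0 lam8; lra.
have tailp : (few_ones p D)%:R <= eps / 2 * 2 ^+ p.
  apply: le_trans (tail p _ _) _ => //; first by nra.
  by rewrite mulrAC ler_pM2r ?exprn_gt0 //; have /= := fs' p pi1; lra.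
have biasp i : (i <= D - J)%N -> (offset_bias p (J + i))%:R <= 2 * x * 2 ^+ p.
  move=> iD; have n0p : (n0 <= p)%N := leq_trans (leq_addr _ _) pi0.
  rewrite -{1}(subnKC n0p); apply: le_trans (@offset_bias_propagate R x n0 (p - n0) J i Gn0) _.
  rewrite subnKC // -mulrA mulr_natl mulr2n lerD2l.
  have -> : x * 2 ^+ p = 2 ^+ n0 * (x * 2 ^+ (p - n0)).
    by rewrite -{1}(subnKC n0p) exprD; ring.
  rewrite ler_pM2l ?exprn_gt0 //.
  apply: (@le_trans _ _ (few_ones (p - n0) D)%:R).
    by rewrite ler_nat few_ones_mono // (leq_trans iD) // leq_subr.
  apply: le_trans (tail _ _ _) _; first exact: leq_subr.
    by rewrite natrB //; nra.
  have i0p : (i0 <= p - n0)%N by rewrite leq_subRL.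
  by rewrite mulrAC ler_pM2r ?exprn_gt0 //; have /= := fs _ i0p; lra.
have sumh : lam * (\sum_(v <- words p) h v)%:R <= 3 * (x * p%:R * 2 ^+ p).
  rewrite /h exchange_big /= natr_sum mulr_sumr.
  apply: (@le_trans _ _ (\sum_(i < D - J) (3 * (2 * x * 2 ^+ p)))).
    apply: ler_sum => i _; rewrite -countE -(count_map offset (heavy lam X (J + i))).
    apply: le_trans (heavy_count _ _ l0) _.
    by rewrite ler_pM2l //; apply: biasp; apply: ltnW.
  rewrite sumr_const card_ord -[leLHS]mulr_natr.
  have : 2 * (D - J)%:R <= p%:R :> R.
    by rewrite natrB //; have := ler0n R J; lra.
  have : 0 < x * 2 ^+ p by rewrite mulr_gt0 ?exprn_gt0.
  have -> : 3 * (x * p%:R * 2 ^+ p) = 3 * ((x * 2 ^+ p) * p%:R) by ring.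
  have -> : 3 * (2 * x * 2 ^+ p) * (D - J)%:R = 3 * ((x * 2 ^+ p) * (2 * (D - J)%:R)) by ring.
  by move=> y0 le; rewrite ler_pM2l // ler_pM2l.
have rare : (count (fun v => lam * p%:R < (h v)%:R) (words p))%:R <= eps / 2 * 2 ^+ p.
  have mk : lam * p%:R * (count (fun v => lam * p%:R < (h v)%:R) (words p))%:R
      <= (\sum_(v <- words p) h v)%:R.
    rewrite countE !natr_sum mulr_sumr; apply: ler_sum => v _.
    by case: ltP => /= [/ltW|_]; rewrite ?mulr1 // mulr0.
  rewrite -(ler_pM2l (mulr_gt0 l0 (mulr_gt0 l0 pR))).
  apply: (@le_trans _ _ (lam * (\sum_(v <- words p) h v)%:R)).
    by rewrite -mulrA ler_pM2l.
  by apply: le_trans sumh _; rewrite /x le_eqVlt; apply/orP; left; apply/eqP; field.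
have -> : eps * 2 ^+ p = eps / 2 * 2 ^+ p + eps / 2 * 2 ^+ p by field.
apply: le_trans _ (lerD tailp rare).
rewrite -natrD ler_nat /few_ones -count_predUI; apply: leq_trans (leq_addr _ _).
apply: sub_count => v; rewrite /bad_block negb_and -ltnNge /= => /orP[-> //|cB].
apply/orP; right; rewrite ltNge; apply: contra cB => hv.
have := residue_count_chain X J (D - J) (offset v) l0; rewrite subnKC // -/(h v) => chain.
rewrite -(ler_pM2r (exprn_gt0 (D - J) (ltr0n R 3))); apply: le_trans chain _.
have c2 : (residue_count (3 ^ J) X (offset v))%:R <= expR (p%:R * ln 2) :> R.
  rewrite (expR_ln_nat R p (n := 2)) // -natrX ler_nat -size_words -(size_map offset).
  exact: count_size.
have lm : (1 + lam) ^+ (D - J) <= expR (lam * p%:R).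
  apply: (@le_trans _ _ (expR lam ^+ (D - J))).
    by rewrite lerXn2r ?nnegrE ?expR_ge0 ?expR_ge1Dx //; lra.
  rewrite -expRM_natr ler_expR; apply: ler_wpM2l; first exact: ltW.
  have : (D - J)%:R <= D%:R :> R by rewrite ler_nat leq_subr.
  lra.
have l3 : 3 ^+ h v <= expR (lam * p%:R * 2).
  rewrite -(expR_ln_nat R _ (n := 3)) // ler_expR.
  apply: ler_pM => //; [exact: ltW (ln3_gt0 R) | exact: ln3_lt2].
apply: (@le_trans _ _ (expR (p%:R * ln 2) * expR (lam * p%:R) * expR (lam * p%:R * 2))).
  apply: ler_pM => //; first by rewrite mulr_ge0 // exprn_ge0 //; lra.
  by apply: ler_pM => //; rewrite exprn_ge0 //; lra.
rewrite /block_bound -(expR_ln_nat R _ (n := 3)) // -!expRD ler_expR natrB //.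
have := ln3_gt0 R; have := ln3_lt2 R; set y := ln 3; set z := ln 2 => y2 y0.
have a1 : y * ((1 - lam) * p%:R / 2 - 1) <= y * D%:R by rewrite ler_pM2l // ltW.
have a2 : y * (1 + J%:R + lam * p%:R / 2) <= 2 * (1 + J%:R + lam * p%:R / 2).
  by rewrite ler_wpM2r // !addr_ge0 // !mulr_ge0 // ltW.
have a3 : eps = 8 * lam by rewrite /lam; field.
rewrite a3 in p1 *; nra.
Unshelve. all: by end_near. Qed.

Lemma ln2_gt0 (R : realType) : 0 < ln 2 :> R.
Proof. by apply: ln_gt0; lra. Qed.

Lemma ln2_le1 (R : realType) : ln 2 <= 1 :> R.
Proof.
have := le_ln1Dx (_ : -1 < (1 : R)); rewrite (_ : 1 + 1 = 2) //; apply; lra.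
Qed.

Lemma exp2E (R : realType) (n : nat) : 2 ^+ n = expR (n%:R * ln 2) :> R.
Proof. by rewrite (expR_ln_nat R n (n := 2)). Qed.

(** * Words made of blocks *)

Lemma sum_words_last_block (R : numDomainType) p K (F : seq bool -> R) :
  \sum_(w <- words (K.+1 * p)) F w =
  \sum_(v <- words p) \sum_(u <- words (K * p)) F (u ++ v).
Proof. by rewrite mulSn addnC words_cat big_allpairs_dep exchange_big. Qed.

Lemma sum_words_blocks (R : comNzRingType) bad p K (z : R) :
  \sum_(w <- words (K * p)) z ^+ bad_count bad p K w =
  (\sum_(v <- words p) z ^+ bad v) ^+ K.
Proof.
elim: K => [|K IH]; first by rewrite mul0n big_seq1 /bad_count big_ord0 !expr0.
rewrite mulSn addnC words_cat big_allpairs_dep exchange_big exprS mulr_suml /=.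
apply: eq_big_seq => v /words_size vp; rewrite -IH mulr_sumr.
apply: eq_big_seq => u /words_size uK.
by rewrite bad_count_cat // exprD mulrC.
Qed.

Lemma sum_pow_bool (R : numDomainType) (T : Type) (P : pred T) (s : seq T) (z : R) :
  \sum_(v <- s) z ^+ P v = (count (predC P) s)%:R + z * (count P s)%:R.
Proof.
rewrite !countE !natr_sum mulr_sumr -big_split /=; apply: eq_bigr => v _.
by case: (P v); rewrite /= ?expr1 ?expr0 ?mulr1 ?mulr0 ?add0r ?addr0.
Qed.

(** The blocks of a random word are independent; exponential Markov
inequality. *)
Lemma many_bad_blocks (R : realType) bad p K (beta a : R) : 0 <= a ->
  (count bad (words p))%:R <= expR (- a) * 2 ^+ p ->
  (count (fun w => beta * K%:R <= (bad_count bad p K w)%:R) (words (K * p)))%:R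
    <= 2 ^+ (K * p) * expR (K%:R * (ln 2 - a * beta)).
Proof.
move=> a0 few_bad.
have : (count (fun w => beta * K%:R <= (bad_count bad p K w)%:R) (words (K * p)))%:R
  <= \sum_(w <- words (K * p)) expR (- (a * beta * K%:R)) * expR a ^+ bad_count bad p K w.
  apply: count_le_sum => w; first by rewrite mulr_ge0 ?exprn_ge0 ?expR_ge0.
  move=> h; rewrite -expRM_natr -expRD -{1}expR0 ler_expR.
  by have := ler_wpM2l a0 h; lra.
move/le_trans; apply; rewrite -mulr_sumr sum_words_blocks sum_pow_bool.
have le : (count (predC bad) (words p))%:R + expR a * (count bad (words p))%:R
   <= 2 ^+ p * 2 :> R.
  have -> : 2 ^+ p * 2 = 2 ^+ p + 2 ^+ p :> R by ring.
  apply: lerD.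
    by rewrite -natrX ler_nat -size_words count_size.
  apply: le_trans (ler_wpM2l (expR_ge0 a) few_bad) _.
  by rewrite mulrA -expRD subrr expR0 mul1r.
have {le} := lerXn2r K (_ : _ \in Num.nneg) (_ : _ \in Num.nneg) le.
move=> le; apply: le_trans (ler_wpM2l (expR_ge0 _) (le _ _)) _.
- by rewrite nnegrE addr_ge0 // mulr_ge0 ?expR_ge0.
- by rewrite nnegrE mulr_ge0 // exprn_ge0.
rewrite exprMn -exprM [(p * K)%N]mulnC mulrCA ler_pM2l ?exprn_gt0 //.
rewrite exp2E -expRD ler_expR le_eqVlt; apply/orP; left; apply/eqP; ring.
Qed.

(** All good blocks that lead to y have offset 2 ^ p * y modulo 3 ^ J, a single
residue class. *)
Lemma good_blocks_to (R : realType) p J (B : R) y : 0 <= B ->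
  (count (fun v => leads v y && ~~ bad_block B p J v) (words p))%:R <= B.
Proof.
move=> B0; set Q := fun v => _.
have [|no] := boolP (has Q (words p)); last first.
  by move: no; rewrite has_count -leqNgt leqn0 => /eqP ->.
move=> /hasP [v0 v0p /andP[l0]]; rewrite negbK => /andP[J0 c0].
apply: le_trans c0; rewrite ler_nat /residue_count count_map.
have congr_y v : v \in words p -> leads v y -> (J <= ones v)%N ->
   offset v = 2 ^ p * y %[mod 3 ^ J].
  move=> /words_size vp /leadsP [m]; rewrite vp => <- Jv.
  by rewrite -(subnK Jv) expnD mulnAC modnMDl.
rewrite -!size_filter; apply: uniq_leq_size; first by rewrite filter_uniq ?uniq_words.
move=> v; rewrite !mem_filter => /andP[/andP[lv]]; rewrite negbK => /andP[Jv _] vp.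
by rewrite vp andbT /= (congr_y v) // (congr_y v0).
Qed.

(** Going backwards from y, the last block is either good, with at most B choices,
or bad, with at most 2 ^ p choices; [pullback] then replaces y. *)
Lemma fiber_moment (R : realType) p J K (B x : R) y : 0 <= B -> 0 <= x ->
  \sum_(w <- words (K * p)) (leads w y)%:R * x ^+ bad_count (bad_block B p J) p K w
    <= (B + x * 2 ^+ p) ^+ K.
Proof.
move=> B0 x0; elim: K y => [|K IH] y.
  rewrite mul0n big_seq1 /bad_count big_ord0 !expr0 mulr1.
  by case: (leads _ _).
rewrite sum_words_last_block.
apply: (@le_trans _ _ (\sum_(v <- words p) (leads v y)%:R * x ^+ bad_block B p J v
   * (B + x * 2 ^+ p) ^+ K)).
  rewrite big_seq_cond [leRHS]big_seq_cond; apply: ler_sum => v; rewrite andbT => vp.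
  apply: le_trans (ler_wpM2l _ (IH (pullback v y))); last first.
    by rewrite mulr_ge0 // exprn_ge0.
  rewrite mulr_sumr big_seq_cond [leRHS]big_seq_cond; apply: ler_sum => u.
  rewrite andbT => /words_size us; rewrite bad_count_cat ?(words_size vp) // exprD.
  case: (boolP (leads (u ++ v) y)) => [/leads_cat/andP[-> ->]|_].
    by rewrite !mul1r mulrC.
  by rewrite mul0r !mulr_ge0 // exprn_ge0.
rewrite -mulr_suml exprS ler_wpM2r ?exprn_ge0 ?addr_ge0 ?mulr_ge0 ?exprn_ge0 //.
apply: (@le_trans _ _ ((count (fun v => leads v y && ~~ bad_block B p J v) (words p))%:R
   + x * (count predT (words p))%:R)); last first.
  rewrite count_predT size_words natrX lerD2r; exact: good_blocks_to.
rewrite !countE !natr_sum mulr_sumr -big_split /=; apply: ler_sum => v _.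
by case: (leads v y); case: (bad_block _ _ _ _);
  rewrite /= ?expr1 ?expr0 ?mul1r ?mul0r ?mulr1 ?add0r ?lerDl ?addr_ge0.
Qed.

(** The moment bound for x = B / 2 ^ p, which balances the two kinds of blocks. *)
Lemma fiber_good_blocks (R : realType) p J K (b beta : R) y :
  0 <= b -> b <= p%:R * ln 2 -> 0 <= beta ->
  (count (fun w => leads w y &&
     ((bad_count (bad_block (expR b) p J) p K w)%:R <= beta * K%:R)) (words (K * p)))%:R
  <= expR (K%:R * (ln 2 + b + beta * p%:R * ln 2)).
Proof.
move=> b0 bp beta0; pose x := expR (b - p%:R * ln 2).
have := @fiber_moment R p J K (expR b) x y (expR_ge0 _) (expR_ge0 _).
have -> : expR b + x * 2 ^+ p = 2 * expR b.
  by rewrite exp2E /x -expRD subrK mulr_natl mulr2n.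
rewrite -(ler_pM2l (expR_gt0 (beta * p%:R * K%:R * ln 2))) => h.
apply: (@le_trans _ _ (expR (beta * p%:R * K%:R * ln 2) * (2 * expR b) ^+ K)); last first.
  rewrite exprMn exp2E -expRM_natl -!expRD ler_expR le_eqVlt.
  by apply/orP; left; apply/eqP; ring.
apply: le_trans h; rewrite mulr_sumr; apply: count_le_sum => w.
  by rewrite !mulr_ge0 ?exprn_ge0 ?expR_ge0.
move=> /andP[-> le]; rewrite mul1r /x -expRM_natl -expRD -{1}expR0 ler_expR.
set n := _%:R in le *; set P := p%:R in bp *.
have L0 : 0 <= P * ln 2 by rewrite mulr_ge0 // ltW // ln2_gt0.
have d0 : 0 <= beta * K%:R - n by rewrite subr_ge0.
have := mulr_ge0 L0 d0; have := mulr_ge0 b0 (ler0n R _ : 0 <= n).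
lra.
Qed.

(** * Concentration of the number of odd steps along orbits *)

Lemma half_le_ln2 (R : realType) : 2^-1 <= ln 2 :> R.
Proof.
have := le_ln1Dx (_ : -1 < (- 2^-1 : R)).
rewrite (_ : 1 + - 2^-1 = 2^-1); last by field.
rewrite lnV ?posrE //; move=> /(_ ltac:(lra)); lra.
Qed.

Lemma ln2_le_ln3 (R : realType) : ln 2 <= ln 3 :> R.
Proof. by rewrite ler_ln ?posrE // ler_nat. Qed.

Lemma ln3_lt_2ln2 (R : realType) : ln 3 < 2 * ln 2 :> R.
Proof.
have -> : 2 * ln 2 = ln (2 ^+ 2) :> R by rewrite lnXn // mulr_natl.
by rewrite ltr_ln ?posrE // ?exprn_gt0 // -natrX ltr_nat.
Qed.

Lemma near_poly_exp (R : realType) (c c1 C : R) : 0 <= C -> c < c1 ->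
  \forall n \near \oo,
    C * (n%:R + 1) * expR (- (c1 * n%:R)) <= expR (- (c * n%:R)).
Proof.
move=> C0 cc1; pose d := (c1 - c) / 2.
have d0 : 0 < d by rewrite /d; lra.
have Z0 : 0 < C * (d^-1 + 1) + 1.
  by rewrite ltr_wpDl // mulr_ge0 // addr_ge0 // invr_ge0 ltW.
have e0 : 0 < (C * (d^-1 + 1) + 1)^-1 by rewrite invr_gt0.
have := near_exp_small d0 e0; apply: filterS => n h.
have le : n%:R + 1 <= (d^-1 + 1) * expR (d * n%:R).
  have h1 := expR_ge1Dx (d * n%:R); rewrite mulrDl mul1r; apply: lerD.
    rewrite -[leLHS](mulKf (lt0r_neq0 d0)) ler_pM2l ?invr_gt0 //; lra.
  by apply: le_trans h1; rewrite lerDl mulr_ge0 // ltW.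
have -> : - (c1 * n%:R) = - (d * n%:R) - d * n%:R - c * n%:R by rewrite /d; field.
rewrite !expRD mulrA -[leRHS]mul1r ler_wpM2r ?expR_ge0 // mulrA.
have {}h : (C * (d^-1 + 1) + 1) * expR (- (d * n%:R)) <= 1.
  by move: h; rewrite -(ler_pM2l Z0) mulfV // lt0r_neq0.
apply: le_trans _ h.
have : C * (n%:R + 1) * expR (- (d * n%:R)) <= C * (d^-1 + 1).
  have := ler_wpM2l C0 le; set E := expR _ => h2.
  have E0 : 0 < expR (- (d * n%:R)) by exact: expR_gt0.
  have EE : E * expR (- (d * n%:R)) = 1 by rewrite -expRD subrr expR0.
  have := ler_wpM2r (ltW E0) h2.
  rewrite -[X in _ <= X -> _]mulrA -[_ * E * _]mulrA EE mulr1.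
  by [].
move=> h3; apply: ler_wpM2r; rewrite ?expR_ge0 //; lra.
Qed.

(** At some time i <= al * n, the number of odd steps among the first i steps is
off i / 2 by more than eps * n / 2. *)
Definition drifting (R : realType) (n : nat) (al eps : R) (m : nat) : bool :=
  `[< exists i : nat, i%:R <= al * n%:R /\
        eps * n%:R < `|2 * (ones (parity i m))%:R - i%:R| >].

(** Exceptional sets must save a power of 2 ^ n, since they are pulled back through
maps whose fibers are only known up to factors 2 ^ (e n). *)
Definition concentrated (R : realType) (al : R) : Prop :=
  forall eps : R, 0 < eps -> exists2 c : R, 0 < c &
    \forall n \near \oo,
      (count (drifting n al eps) (iota 0 (2 ^ n)))%:R <= expR (n%:R * (ln 2 - c)).

Lemma concentrated0 (R : realType) : concentrated (0 : R).
Proof.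
move=> eps e0; exists 1 => //; near=> n.
rewrite (@eq_count _ _ pred0) ?count_pred0 ?expR_ge0 // => m.
apply/asboolP => -[i []]; rewrite mul0r => i0.
have -> : i = 0%N by apply/eqP; rewrite -leqn0 -(ler_nat R).
by rewrite /ones /= mulr0 subr0 normr0 ltNge mulr_ge0 // ltW.
Unshelve. all: by end_near. Qed.

Lemma concentrated_le (R : realType) (al al' : R) : al' <= al ->
  concentrated al -> concentrated al'.
Proof.
move=> le H eps e0; have [c c0 Hc] := H _ e0; exists c => //.
move: Hc; apply: filterS => n; apply: le_trans; rewrite ler_nat.
apply: sub_count => m /asboolP [i [h1 h2]]; apply/asboolP; exists i; split => //.
by apply: le_trans h1 _; rewrite ler_wpM2r.
Qed.

Lemma count_sub3 (I : Type) (P A B C : pred I) (s : seq I) :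
  (forall x, P x -> [|| A x, B x | C x]) ->
  (count P s <= count A s + (count B s + count C s))%N.
Proof.
move=> sub; elim: s => //= x s IH; have := sub x.
case: (P x) => h; last by apply: leq_trans IH _; rewrite !leq_add // leq_addl.
have {h} := h isT; case: (A x); case: (B x); case: (C x) => //= _; lia.
Qed.

(** Double counting over the image y = f m. *)
Lemma count_fibers (f : nat -> nat) (P Q : pred nat) N (s : seq nat) :
  (count (fun m => [&& f m < N, P (f m) & Q m]) s <=
   \sum_(y <- iota 0 N) P y * count (fun m => (f m == y) && Q m) s)%N.
Proof.
elim: s => [|m s IH] //=.
under eq_bigr => y _ do rewrite mulnDr.
rewrite big_split /= leq_add //.
case: (ltnP (f m) N) => //= fN; case: (boolP (P (f m))) => //= Pf; case: (Q m) => //=.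
rewrite (bigD1_seq (f m)) ?iota_uniq ?mem_iota //=.
by rewrite Pf eqxx leq_addr.
Qed.

Lemma early_drift (R : realType) (n s : nat) (e : R) : (s <= n)%N -> 0 < e -> e <= 1 ->
  (count (fun m => has (fun i => e * n%:R < `|2 * (ones (parity i m))%:R - i%:R|)
     (iota 0 s.+1)) (iota 0 (2 ^ n)))%:R <=
  2 ^+ n * (2 * (n%:R + 1) * expR (- (e ^+ 2 / 8 * n%:R))).
Proof.
move=> sn e0 e1.
pose D i m := e * n%:R < `|2 * (ones (parity i m))%:R - i%:R|.
have U r : (count (fun m => has (D ^~ m) r) (iota 0 (2 ^ n)) <=
    \sum_(i <- r) count (D i) (iota 0 (2 ^ n)))%N.
  elim: r => [|i r IH]; first by rewrite big_nil /= count_pred0.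
  rewrite big_cons; apply: leq_trans _ (leq_add (leqnn _) IH).
  by rewrite -count_predUI leq_addr.
apply: (@le_trans _ _ (\sum_(i <- iota 0 s.+1) (count (D i) (iota 0 (2 ^ n)))%:R)).
  by rewrite -natr_sum ler_nat; exact: U.
apply: (@le_trans _ _ (\sum_(i <- iota 0 s.+1)
   (2 ^+ n * (2 * expR (- (e ^+ 2 / 8 * n%:R)))))).
  rewrite big_seq_cond [leRHS]big_seq_cond; apply: ler_sum => i.
  rewrite mem_iota add0n ltnS andbT => /= i_s.
  have i_n : (i <= n)%N := leq_trans i_s sn.
  rewrite (count_parity (fun w => e * n%:R < `|2 * (ones w)%:R - i%:R|) i_n).
  have := deviating_words e0 e1 i_n; rewrite natrM natrX => h.
  apply: le_trans (ler_wpM2l (exprn_ge0 _ (ler0n R 2)) h) _.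
  have -> : 2 ^+ n = 2 ^+ (n - i) * 2 ^+ i :> R by rewrite -exprD subnK.
  by rewrite le_eqVlt; apply/orP; left; apply/eqP; ring.
rewrite big_const_seq count_predT size_iota iter_addr_0 -[leLHS]mulr_natr.
set E := expR _; have E0 : 0 <= 2 ^+ n * (2 * E) by rewrite !mulr_ge0 ?exprn_ge0 ?expR_ge0.
have -> : 2 ^+ n * (2 * (n%:R + 1) * E) = 2 ^+ n * (2 * E) * (n%:R + 1) by ring.
by rewrite ler_wpM2l // natr1 ler_nat.
Qed.

Lemma orbit_bound s n p m : (s <= n)%N -> (n < s + p)%N -> (m < 2 ^ n)%N ->
  (iter s shortcut m < 3 ^ ones (parity s m) * 2 ^ p)%N.
Proof.
move=> sn np mn; have h := parity_orbit s m.
have := offset_le (parity s m); rewrite size_parity.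
rewrite -(ltn_pmul2l (_ : 0 < 2 ^ s)%N) ?expn_gt0 // h.
have : (2 ^ n * 2 <= 2 ^ s * 2 ^ p)%N by rewrite -expnSr -expnD leq_exp2l.
have : (2 ^ s <= 2 ^ n)%N by rewrite leq_exp2l.
have : (0 < 3 ^ ones (parity s m))%N by rewrite expn_gt0.
move: (3 ^ _)%N (2 ^ n)%N (2 ^ s)%N (2 ^ p)%N (offset _) mn {h} => a N S P c.
clear; nia.
Qed.

(** If m is balanced up to time s, an imbalance at a later time s + i is an
imbalance of iter s shortcut m at time i. *)
Lemma drift_cover (R : realType) (n s p n' m : nat) (al al' e eps : R) :
  (s <= n)%N -> (n < s + p)%N -> (m < 2 ^ n)%N ->
  e <= eps -> e * n%:R + eps / 4 * n'%:R <= eps * n%:R ->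
  (forall i, (s + i)%:R <= al' * n%:R -> i%:R <= al * n'%:R) ->
  n%:R * (1 + e) / 2 * ln 3 + p%:R * ln 2 <= n'%:R * ln 2 ->
  drifting n al' eps m ->
  ~~ has (fun i => e * n%:R < `|2 * (ones (parity i m))%:R - i%:R|) (iota 0 s.+1) ->
  (iter s shortcut m < 2 ^ n')%N && drifting n' al (eps / 4) (iter s shortcut m).
Proof.
move=> sn nsp mn ee H3 H2 H4 /asboolP [i [ial dev]] /hasPn calm.
have {}calm j : (j <= s)%N -> `|2 * (ones (parity j m))%:R - j%:R| <= e * n%:R.
  by move=> js; rewrite leNgt; apply: calm; rewrite mem_iota add0n ltnS.
have calms := calm s (leqnn s).
apply/andP; split.
  apply: (leq_trans (orbit_bound sn nsp mn)).
  rewrite -(ler_nat R) natrM !natrX !(exp2E R) -(expR_ln_nat R _ (n := 3)) //.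
  rewrite -expRD ler_expR; apply: le_trans H4; rewrite lerD2r.
  rewrite ler_wpM2r ?(ltW (ln3_gt0 R)) //.
  have : s%:R <= n%:R :> R by rewrite ler_nat.
  move: calms; rewrite ler_norml => /andP[_]; clear; lra.
have si : (s < i)%N.
  rewrite ltnNge; apply/negP => /calm le.
  have := lt_le_trans dev le; rewrite ltNge => /negP[].
  by rewrite ler_wpM2r.
have [j ij] : exists j, i = (s + j)%N by exists (i - s)%N; rewrite subnKC // ltnW.
subst i; apply/asboolP; exists j; split; first exact: H2.
rewrite ltNge; apply/negP => le.
move: dev; rewrite ltNge => /negP[]; apply: le_trans H3.
rewrite parity_cat ones_cat !natrD.
have -> : 2 * ((ones (parity s m))%:R + (ones (parity j (iter s shortcut m)))%:R) - (s%:R + j%:R) =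
  (2 * (ones (parity s m))%:R - s%:R) + (2 * (ones (parity j (iter s shortcut m)))%:R - j%:R) :> R.
  by ring.
by apply: le_trans (ler_normD _ _) _; apply: lerD.
Qed.

Lemma count_bad_blocks (R : realType) (n p K : nat) bad (beta a : R) :
  (K * p <= n)%N -> 0 <= a ->
  (count bad (words p))%:R <= expR (- a) * 2 ^+ p ->
  (count (fun m => beta * K%:R <= (bad_count bad p K (parity (K * p) m))%:R)
     (iota 0 (2 ^ n)))%:R <= 2 ^+ n * expR (K%:R * (ln 2 - a * beta)).
Proof.
move=> sn a0 few_bad.
rewrite (count_parity (fun w => beta * K%:R <= (bad_count bad p K w)%:R) sn).
rewrite natrM natrX; have := many_bad_blocks K beta a0 few_bad => h.
apply: le_trans (ler_wpM2l (exprn_ge0 _ (ler0n R 2)) h) _.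
by rewrite mulrA -exprD subnK.
Qed.

Lemma count_bad_images (R : realType) (n s n' : nat) (P : pred nat)
    (Q : pred (seq bool)) (M : R) :
  (forall y, (count (fun w => leads w y && Q w) (words s))%:R <= M) ->
  (count (fun m => [&& (iter s shortcut m < 2 ^ n')%N, P (iter s shortcut m) & Q (parity s m)])
     (iota 0 (2 ^ n)))%:R <= M * (count P (iota 0 (2 ^ n')))%:R.
Proof.
move=> fib.
have := count_fibers (iter s shortcut) P (fun m => Q (parity s m)) (2 ^ n') (iota 0 (2 ^ n)).
rewrite -(ler_nat R) => h; apply: le_trans h _.
rewrite natr_sum countE natr_sum mulr_sumr; apply: ler_sum => y _.
rewrite natrM mulrC ler_wpM2r //; apply: le_trans (fib y).
by rewrite ler_nat; exact: fiber_le_words.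
Qed.

(** The number of bad images times the size of a fiber, in logarithms: the main
terms are n' ln 2 = n ln 3 / 2 and K p (ln 2 - ln 3 / 2), which add up to
n ln 2, and the saving c on the images outweighs all losses of order e. *)
Lemma image_exponent (R : realType) (n n' K p : nat) (rho e c b beta L2 L3 : R) :
  2^-1 <= L2 -> L2 <= 1 -> L2 <= L3 -> rho * (2 * L2) = L3 ->
  0 < e -> e <= 1 -> 0 < c -> c <= 2^-1 -> 20 * e <= c ->
  n'%:R <= n%:R * (rho + 2 * e) + 1 -> n%:R * rho <= n'%:R ->
  (K * p <= n)%N -> 1 <= e * p%:R -> beta = e ->
  b <= p%:R * (L2 - L3 / 2 + e) -> 0 <= L2 - L3 / 2 ->
  K%:R * (L2 + b + beta * p%:R * L2) + n'%:R * (L2 - c)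
   <= n%:R * L2 + 1 - c / 4 * n%:R.
Proof.
move=> h1 h2 h3 hr e0 e1 c0 c1 ec nhi nlo Kp ep -> bb d0.
have KpR : K%:R * p%:R <= n%:R :> R by rewrite -natrM ler_nat.
have K0 : 0 <= K%:R :> R by [].
have n0 : 0 <= n%:R :> R by [].
have p0 : 0 <= p%:R :> R by [].
have A : K%:R * (L2 + b + e * p%:R * L2) <= n%:R * (L2 - L3 / 2 + 3 * e).
  apply: (@le_trans _ _ (K%:R * (p%:R * (L2 - L3 / 2 + 3 * e)))); last first.
    rewrite mulrA ler_wpM2r //; lra.
  apply: ler_wpM2l => //.
  have : e * p%:R * L2 <= e * p%:R by rewrite -[leRHS]mulr1 ler_wpM2l // mulr_ge0 // ltW.
  lra.
have B : n'%:R * (L2 - c) <= (n%:R * (rho + 2 * e) + 1) * L2 - c * (n%:R * rho).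
  rewrite mulrBr lerB //; first by rewrite ler_wpM2r //; lra.
  by rewrite [leRHS]mulrC ler_wpM2l // ltW.
have rho2 : 2^-1 <= rho.
  by rewrite -(ler_pM2r (_ : 0 < 2 * L2)) ?hr; lra.
have C : (n%:R * (rho + 2 * e) + 1) * L2 = n%:R * (L3 / 2) + 2 * (e * n%:R) * L2 + L2.
  by rewrite -hr; field.
have D : 2 * (e * n%:R) * L2 <= 2 * (e * n%:R).
  by rewrite -[leRHS]mulr1 ler_wpM2l // !mulr_ge0 // ltW.
have E : c * (n%:R * 2^-1) <= c * (n%:R * rho).
  by rewrite ler_wpM2l ?ler_wpM2l // ltW.
have F : (20 * e) * n%:R <= c * n%:R by rewrite ler_wpM2r.
lra.
Qed.

(** The exceptional m below 2 ^ n are of three kinds: those unbalanced within the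
first s steps, those with many bad blocks, and those with few bad blocks whose
image is exceptional.  The block length p is chosen after the rate c of the
images, so that the losses of order e in the fibers stay below the saving. *)
Lemma concentrated_step (R : realType) (al al' : R) : 0 <= al ->
  al' < 1 + ln 3 / (2 * ln 2) * al -> concentrated al -> concentrated al'.
Proof.
move=> al0 alal' H eps eps0.
have L2h := half_le_ln2 R; have L21 := ln2_le1 R; have L23 := ln2_le_ln3 R.
have L32 := ltW (ln3_lt_2ln2 R).
set rho := ln 3 / (2 * ln 2) in alal'.
have L20 : 0 < 2 * ln 2 :> R by clear -L2h; lra.
have hr : rho * (2 * ln 2) = ln 3 by rewrite /rho mulfVK // lt0r_neq0.
have rho1 : rho <= 1 by rewrite -(ler_pM2r L20) hr mul1r.
have rho0 : 2^-1 <= rho by rewrite -(ler_pM2r L20) hr; clear -L2h L23; lra.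
have eps4 : 0 < eps / 4 by clear -eps0; lra.
have [c1 c10 Hc1] := H _ eps4.
pose c := Num.min c1 2^-1.
have c0 : 0 < c by rewrite lt_min c10 /= invr_gt0 ltr0n.
have cle : c <= 2^-1 by rewrite ge_min lexx orbT.
have Hc : \forall n \near \oo, (count (drifting n al (eps / 4)) (iota 0 (2 ^ n)))%:R
     <= expR (n%:R * (ln 2 - c)).
  move: Hc1; apply: filterS => n; move/le_trans; apply.
  by rewrite ler_expR ler_wpM2l // lerB // ge_min lexx.
have [n1 _ {}Hc] := Hc.
pose e := Num.min (eps / 4) (c / 20).
have e0 : 0 < e by rewrite lt_min eps4 /=; clear -c0; lra.
have e_eps : e <= eps / 4 by rewrite ge_min lexx.
have ec : 20 * e <= c.
  have : e <= c / 20 by rewrite ge_min lexx orbT.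
  by clear; lra.
have e40 : e <= 40^-1 by clear -ec cle; lra.
pose a := 2 / e.
have a0 : 0 <= a by rewrite divr_ge0 ?ler0n // ltW.
have ae : a * e = 2 by rewrite /a mulfVK // lt0r_neq0.
(* The density exp (- a) of bad blocks makes a fraction e of bad blocks as
unlikely as exp (- a * e) = exp (- 2) per block, which beats the factor 2 per
block in many_bad_blocks. *)
pose e' := Num.min e (expR (- a)).
have e'0 : 0 < e' by rewrite lt_min e0 expR_gt0.
have e'e : e' <= e by rewrite ge_min lexx.
have e'1 : e' <= 1 by clear -e'e e40; lra.
have [L [_ HL]] : exists L : nat, True /\ forall p, (L <= p)%N -> 1 <= e * p%:R.
  by have [L _ h] := near_linear 1 e0; exists L; split => // p; exact: h.
have [p [J [Lp p0 few_bad]]] := most_blocks_good L e'0 e'1.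
have ep := HL p Lp.
set b := p%:R * (ln 2 - ln 3 / 2 + e').
have pR : 0 < p%:R :> R by rewrite ltr0n.
have d0 : 0 <= ln 2 - ln 3 / 2 :> R by clear -L32; lra.
have b0 : 0 <= b by rewrite mulr_ge0 // addr_ge0 // ltW.
have bp : b <= p%:R * ln 2.
  by rewrite ler_pM2l //; clear -e'e e40 L2h L23; lra.
have bp' : b <= p%:R * (ln 2 - ln 3 / 2 + e) by rewrite ler_pM2l // lerD2l.
have few_bad' : (count (bad_block (expR b) p J) (words p))%:R <= expR (- a) * 2 ^+ p.
  apply: le_trans few_bad _; rewrite ler_wpM2r ?exprn_ge0 //.
  by rewrite ge_min lexx orbT.
pose r := Num.min (e ^+ 2 / 16) (Num.min (2 * p%:R)^-1 (c / 8)).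
have r0 : 0 < r by rewrite !lt_min !divr_gt0 ?exprn_gt0 //= invr_gt0 mulr_gt0.
have rA : r < e ^+ 2 / 8.
  have : r <= e ^+ 2 / 16 by rewrite ge_min lexx.
  by have := exprn_gt0 2 e0; clear; lra.
have rB : r < p%:R^-1.
  have : r <= (2 * p%:R)^-1 by rewrite !ge_min lexx orbT.
  by rewrite invfM; have : 0 < p%:R^-1 :> R; [rewrite invr_gt0 | clear; lra].
have rC : r < c / 4.
  have : r <= c / 8 by rewrite !ge_min lexx !orbT.
  by clear -c0; lra.
exists r => //.
have nA := near_poly_exp (ler0n R 6) rA.
have nB := near_poly_exp (mulr_ge0 (ler0n R 3) (expR_ge0 (1 : R))) rB.
have nC := near_poly_exp (mulr_ge0 (ler0n R 3) (expR_ge0 (1 : R))) rC.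
have g0 : 0 < 1 + rho * al - al' by clear -alal'; lra.
have lin1 := near_linear p%:R g0.
have lin2 := near_linear p%:R e0.
near=> n.
have hA : 6 * (n%:R + 1) * expR (- (e ^+ 2 / 8 * n%:R)) <= expR (- (r * n%:R)) by near: n.
have hB : 3 * expR 1 * (n%:R + 1) * expR (- (p%:R^-1 * n%:R)) <= expR (- (r * n%:R)) by near: n.
have hC : 3 * expR 1 * (n%:R + 1) * expR (- (c / 4 * n%:R)) <= expR (- (r * n%:R)) by near: n.
have hlin1 : p%:R <= (1 + rho * al - al') * n%:R by near: n.
have hlin2 : p%:R <= e * n%:R by near: n.
have nn1 : (2 * n1 <= n)%N by near: n; exact: nbhs_infty_ge.
have n_gt0 : (0 < n)%N by near: n; exact: nbhs_infty_ge.
have n0 : 0 <= n%:R :> R by [].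
set K := (n %/ p)%N; set s := (K * p)%N.
have sn : (s <= n)%N by exact: leq_trunc_div.
have nsp : (n < s + p)%N by rewrite {1}(divn_eq n p) ltn_add2l ltn_mod.
(* The images are below 3 ^ o * 2 ^ p with o <= (1 + e) n / 2, hence below
2 ^ n'. *)
pose n' := (Num.truncn (n%:R * (rho + 2 * e))).+1.
have re0 : 0 <= n%:R * (rho + 2 * e).
  by rewrite mulr_ge0 //; clear -rho0 e0; lra.
have /andP[n'hi n'lo] := truncn_itv re0.
have {}n'hi : n'%:R <= n%:R * (rho + 2 * e) + 1 by rewrite /n' -natr1 lerD2r.
have {}n'lo : n%:R * (rho + 2 * e) <= n'%:R by exact: ltW.
clearbody n'.
have en0 : 0 <= e * n%:R by rewrite mulr_ge0 // ltW.
have n'rho : n%:R * rho <= n'%:R by clear -n'lo en0; lra.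
have n1n' : (n1 <= n')%N.
  rewrite -(ler_nat R); apply: le_trans n'rho.
  have : (2 * n1)%:R <= n%:R :> R by rewrite ler_nat.
  have : n%:R * 2^-1 <= n%:R * rho by rewrite ler_wpM2l.
  by rewrite natrM; clear; lra.
have nge1 : 1 <= n%:R :> R by rewrite ler1n.
have KpR : K%:R * p%:R <= n%:R :> R by rewrite -natrM ler_nat.
pose A m := has (fun i => e * n%:R < `|2 * (ones (parity i m))%:R - i%:R|) (iota 0 s.+1).
pose B m := e * K%:R <= (bad_count (bad_block (expR b) p J) p K (parity s m))%:R.
pose Q w := (bad_count (bad_block (expR b) p J) p K w)%:R <= e * K%:R.
pose C m := [&& (iter s shortcut m < 2 ^ n')%N, drifting n' al (eps / 4) (iter s shortcut m) & Q (parity s m)].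
have cover m : (m < 2 ^ n)%N && drifting n al' eps m -> [|| A m, B m | C m].
  move=> /andP[mn dr]; case: (boolP (A m)) => //= notA.
  have := @drift_cover R n s p n' m al al' e eps sn nsp mn _ _ _ _ dr notA.
  move=> W; have /andP[W1 W2] : (iter s shortcut m < 2 ^ n')%N && drifting n' al (eps / 4) (iter s shortcut m).
    apply: W.
    - by clear -e_eps eps0; lra.
    - have : e * n%:R <= eps / 4 * n%:R by rewrite ler_wpM2r.
      have : eps / 4 * n'%:R <= eps / 4 * (3 * n%:R).
        rewrite ler_pM2l //; apply: le_trans n'hi _.
        have : n%:R * (rho + 2 * e) <= n%:R * 2.
          by rewrite ler_wpM2l //; clear -rho1 e40; lra.
        by clear -nge1; lra.
      by clear; lra.
    - move=> i; rewrite natrD => le.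
      have : n%:R <= s%:R + p%:R :> R by rewrite -natrD ler_nat ltnW.
      have : al * (n%:R * rho) <= al * n'%:R by rewrite ler_wpM2l.
      by clear -le hlin1; lra.
    - have L2n : ln 2 * (n%:R * (rho + 2 * e)) <= ln 2 * n'%:R.
        by rewrite ler_wpM2l //; clear -L2h; lra.
      have E : ln 2 * (n%:R * (rho + 2 * e)) = n%:R * (ln 3 / 2) + 2 * (e * n%:R * ln 2).
        by rewrite -hr; field.
      have F1 : p%:R * ln 2 <= e * n%:R * ln 2 by rewrite ler_wpM2r //; clear -L2h; lra.
      have F2 : e * n%:R * ln 3 <= e * n%:R * (2 * ln 2) by rewrite ler_wpM2l.
      by clear -L2n E F1 F2; lra.
  rewrite /B /C W1 W2 /= /Q.
  by case: (leP (e * K%:R)) => //= /ltW.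
have eqc : count (drifting n al' eps) (iota 0 (2 ^ n)) =
   count (fun m => (m < 2 ^ n)%N && drifting n al' eps m) (iota 0 (2 ^ n)).
  by apply: eq_in_count => m; rewrite mem_iota add0n /= => ->.
have := count_sub3 (iota 0 (2 ^ n)) cover; rewrite -eqc -(ler_nat R) !natrD => tot.
apply: le_trans tot _.
have cA := early_drift sn e0 (_ : e <= 1).
have {}cA := cA ltac:(by clear -e40; lra).
have cB := count_bad_blocks e sn a0 few_bad'.
have fib y := @fiber_good_blocks R p J K b e y b0 bp (ltW e0).
have cC := @count_bad_images R n s n' (drifting n' al (eps / 4)) Q _ fib.
have Kn : n%:R / p%:R <= K%:R + 1 :> R.
  rewrite ler_pdivrMr // mulrDl mul1r -natrM -natrD ler_nat; exact: ltnW.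
have eB : K%:R * (ln 2 - a * e) <= 1 - p%:R^-1 * n%:R.
  have : K%:R * (ln 2 - a * e) <= K%:R * -1.
    by rewrite ler_wpM2l // ae; clear -L21; lra.
  by move: Kn; rewrite mulrC; clear; lra.
have eC := @image_exponent R n n' K p rho e c b e (ln 2) (ln 3) L2h L21 L23 hr e0
   _ c0 cle ec n'hi n'rho sn ep erefl bp' d0.
have {}eC := eC ltac:(by clear -e40; lra).
have X : expR (n%:R * (ln 2 - r)) = 2 ^+ n * expR (- (r * n%:R)).
  by rewrite exp2E -expRD; congr expR; ring.
rewrite X; set Z := expR (- (r * n%:R)) in hA hB hC *.
have N0 : 0 <= 2 ^+ n :> R by rewrite exprn_ge0.
have sA : 3 * (count A (iota 0 (2 ^ n)))%:R <= 2 ^+ n * Z.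
  have := ler_wpM2l N0 hA; have := cA; clear; lra.
have e1n (x : R) : 0 <= x -> 3 * expR 1 * (n%:R + 1) * x <= Z -> 3 * expR 1 * x <= Z.
  move=> x0; apply: le_trans; rewrite ler_wpM2r // -[leLHS]mulr1.
  by apply: ler_wpM2l; rewrite ?lerDr // mulr_ge0 ?expR_ge0 ?ler0n.
have {}hB := e1n _ (expR_ge0 _) hB; have {}hC := e1n _ (expR_ge0 _) hC.
have sB : 3 * (count B (iota 0 (2 ^ n)))%:R <= 2 ^+ n * Z.
  have le2 : expR (K%:R * (ln 2 - a * e)) <= expR 1 * expR (- (p%:R^-1 * n%:R)).
    by rewrite -expRD ler_expR.
  have := le_trans cB (ler_wpM2l N0 le2); have := ler_wpM2l N0 hB; clear; lra.
have sC : 3 * (count C (iota 0 (2 ^ n)))%:R <= 2 ^+ n * Z.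
  have h1 := Hc n' n1n'.
  have h2 := le_trans cC (ler_wpM2l (expR_ge0 _) h1); rewrite -expRD in h2.
  have h3 : (count C (iota 0 (2 ^ n)))%:R <= 2 ^+ n * (expR 1 * expR (- (c / 4 * n%:R))).
    by apply: le_trans h2 _; rewrite exp2E -!expRD ler_expR addrA.
  have := ler_wpM2l N0 hC; move: h3; clear; lra.
by move: sA sB sC; clear; lra.
Unshelve. all: by end_near. Qed.

(** The numbers be * (1 - rho ^ j) approach be, and each is less than
1 + rho times the previous one as soon as be * (1 - rho) < 1. *)
Lemma concentrated_all (R : realType) (al : R) :
  al * (1 - ln 3 / (2 * ln 2)) < 1 -> concentrated al.
Proof.
have L2h := half_le_ln2 R; have L32 := ln3_lt_2ln2 R; have L30 := ln3_gt0 R.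
set rho := ln 3 / (2 * ln 2) => al1.
have L20 : 0 < 2 * ln 2 :> R by clear -L2h; lra.
have rho1 : rho < 1 by rewrite ltr_pdivrMr // mul1r.
have rho0 : 0 < rho by rewrite divr_gt0.
have s0 : 0 < 1 - rho by rewrite subr_gt0.
case: (leP al 0) => [/concentrated_le|al0]; first by apply; exact: concentrated0.
(* The target al itself is only approached, so aim at a larger limit. *)
pose be := (al + (1 - rho)^-1) / 2.
have inv : al < (1 - rho)^-1 by rewrite -(ltr_pM2r s0) mulVf // lt0r_neq0.
have albe : al < be by rewrite /be; clear -inv; lra.
have be1 : be * (1 - rho) < 1.
  rewrite -[ltRHS](mulVf (lt0r_neq0 s0)).
  by rewrite ltr_pM2r // /be; clear -inv; lra.
have be0 : 0 < be := lt_trans al0 albe.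
have step j : concentrated (be * (1 - rho ^+ j)).
  elim: j => [|j IH]; first by rewrite expr0 subrr mulr0; exact: concentrated0.
  apply: concentrated_step IH.
    by rewrite mulr_ge0 ?(ltW be0) // subr_ge0 exprn_ile1 ?ltW.
  rewrite -/rho -subr_gt0.
  have -> : 1 + rho * (be * (1 - rho ^+ j)) - be * (1 - rho ^+ j.+1) =
    1 - be * (1 - rho) by rewrite exprS; ring.
  by rewrite subr_gt0.
have t0 : 0 < (be - al) / be by rewrite divr_gt0 // subr_gt0.
have [N _ /(_ N (leqnn N)) /= small] := near_exp_small s0 t0.
apply: concentrated_le (step N).
have : rho ^+ N <= (be - al) / be.
  apply: le_trans _ small; rewrite -mulNr expRM_natr lerXn2r ?nnegrE ?expR_ge0 ?(ltW rho0) //.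
  by apply: le_trans (expR_ge1Dx _); clear; lra.
by rewrite ler_pdivlMr //; clear; lra.
Qed.

(** * From the shortcut map to the Collatz map *)

Lemma iter_Col_shortcut i m : iter (i + ones (parity i m)) Col m = iter i shortcut m.
Proof.
elim: i m => [|i IH] m //.
have -> : (i.+1 + ones (parity i.+1 m) = (i + ones (parity i (shortcut m))) + (1 + odd m))%N.
  by rewrite /ones /=; lia.
rewrite iterD iterSr -IH; congr iter.
rewrite /Col /shortcut; case: (boolP (odd m)) => o /=; last by rewrite (negbTE o) divn2.
by rewrite o oddD oddM o /= divn2.
Qed.

Lemma parityS i m : parity i.+1 m = parity i m ++ [:: odd (iter i shortcut m)].
Proof. by rewrite -addn1 parity_cat. Qed.

(** Before time i0 consecutive values of i + ones (parity i m) differ by at most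
2, so every k is met up to one step; for larger k, i0 is used. *)
Lemma Col_window i0 k m : exists i, [/\ (i <= i0)%N, (i + ones (parity i m) <= k)%N &
  (k <= (i + ones (parity i m)).+1)%N \/ i = i0].
Proof.
elim: i0 => [|i0 [i [ii ik]]]; first by exists 0%N; split => //; right.
case=> [near|ii0]; first by exists i; split => //; [exact: leqW | left].
subst i; case: (leqP (i0.+1 + ones (parity i0.+1 m)) k) => le.
  by exists i0.+1; split => //; right.
exists i0; split => //; left.
move: le; rewrite parityS ones_cat /ones /= addn0; case: (odd _); lia.
Qed.

Lemma Col_step x : (0 < x)%N -> [/\ (0 < Col x)%N, (x <= 2 * Col x)%N & (Col x <= 4 * x)%N].
Proof.
rewrite /Col => x0; case: ifP => o; first by split; lia.
have := divn_eq x 2; rewrite modn2 o addn0 => e; split; lia.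
Qed.

Lemma Col_steps d x : (0 < x)%N ->
  [/\ (0 < iter d Col x)%N, (x <= 2 ^ d * iter d Col x)%N & (iter d Col x <= 4 ^ d * x)%N].
Proof.
move=> x0; elim: d => [|d [p lo hi]]; first by rewrite /= !mul1n.
have [p' lo' hi'] := Col_step p; rewrite iterS !expnS; split => //.
- apply: leq_trans lo _; rewrite [(2 * _)%N]mulnC -mulnA leq_mul2l lo' orbT //.
- by apply: leq_trans hi' _; rewrite -mulnA leq_mul2l hi orbT.
Qed.

Lemma shortcut_gt0 i m : (0 < m)%N -> (0 < iter i shortcut m)%N.
Proof. by move=> /(Col_steps (i + ones (parity i m)))[+ _ _]; rewrite iter_Col_shortcut. Qed.

(** As long as x >= D, the added 1 costs at most a factor 1 + 1 / D:
2 * D * shortcut x <= 3 ^ odd x * (D + 1) * x. *)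
Lemma shortcut_upper i m D : (forall j, (j < i)%N -> (D <= iter j shortcut m)%N) ->
  ((2 * D) ^ i * iter i shortcut m <= 3 ^ ones (parity i m) * D.+1 ^ i * m)%N.
Proof.
elim: i => [|i IH] big; first by rewrite /= !mul1n.
have {}IH := IH (fun j ji => big j (leqW ji)); have {}big := big i (leqnn _).
rewrite parityS ones_cat [ones [:: _]]/ones /= addn0 expnD.
have := shortcut_double (iter i shortcut m); move: (iter i shortcut m) IH big => x IH big Tx.
rewrite [((2 * D) ^ _)%N]expnSr -mulnA.
have step : (2 * D * shortcut x <= 3 ^ odd x * D.+1 * x)%N.
  by move: Tx; case: (odd x); rewrite ?expn1 ?expn0; nia.
apply: (@leq_trans ((2 * D) ^ i * (3 ^ odd x * D.+1 * x))); first by rewrite leq_mul2l step orbT.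
rewrite expnS.
have -> : ((2 * D) ^ i * (3 ^ odd x * D.+1 * x) = (3 ^ odd x * D.+1) * ((2 * D) ^ i * x))%N by lia.
have -> : (3 ^ ones (parity i m) * 3 ^ odd x * (D.+1 * D.+1 ^ i) * m =
  (3 ^ odd x * D.+1) * (3 ^ ones (parity i m) * D.+1 ^ i * m))%N by lia.
by rewrite leq_mul2l IH orbT.
Qed.

Lemma shortcut_lower i m : (3 ^ ones (parity i m) * m <= 2 ^ i * iter i shortcut m)%N.
Proof. by rewrite parity_orbit leq_addr. Qed.

Lemma ler_ln_nat (R : realType) (a b : nat) : (0 < a)%N -> (a <= b)%N ->
  ln a%:R <= ln b%:R :> R.
Proof.
move=> a0 ab; rewrite ler_ln ?ler_nat // posrE ltr0n //; exact: leq_trans ab.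
Qed.

Lemma ln_mul_nat (R : realType) (a b : nat) : (0 < a)%N -> (0 < b)%N ->
  ln (a * b)%:R = ln a%:R + ln b%:R :> R.
Proof. by move=> a0 b0; rewrite natrM lnM // posrE ltr0n. Qed.

Lemma ln_exp_nat (R : realType) (a k : nat) : (0 < a)%N ->
  ln (a ^ k)%:R = k%:R * ln a%:R :> R.
Proof. by move=> a0; rewrite natrX lnXn ?ltr0n // mulr_natl. Qed.

Lemma shortcut_log_lower (R : realType) i m : (0 < m)%N ->
  (ones (parity i m))%:R * ln 3 - i%:R * ln 2 + ln m%:R <= ln (iter i shortcut m)%:R :> R.
Proof.
move=> m0; have p3 : (0 < 3 ^ ones (parity i m))%N by rewrite expn_gt0.
have := @ler_ln_nat R _ _ _ (shortcut_lower i m).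
rewrite muln_gt0 p3 m0 => /(_ isT).
rewrite !ln_mul_nat ?expn_gt0 ?shortcut_gt0 // !ln_exp_nat //; lra.
Qed.

Lemma shortcut_log_upper (R : realType) i m D : (0 < m)%N -> (0 < D)%N ->
  (forall j, (j < i)%N -> (D <= iter j shortcut m)%N) ->
  ln (iter i shortcut m)%:R <=
    (ones (parity i m))%:R * ln 3 - i%:R * ln 2 + ln m%:R + i%:R / D%:R :> R.
Proof.
move=> m0 D0 big; have X0 := shortcut_gt0 i m0.
have := @ler_ln_nat R _ _ _ (shortcut_upper big).
rewrite muln_gt0 expn_gt0 muln_gt0 D0 X0 => /(_ isT).
rewrite !ln_mul_nat ?expn_gt0 ?muln_gt0 ?D0 ?expn_gt0 // !ln_exp_nat ?muln_gt0 ?D0 //.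
rewrite ln_mul_nat // => h.
have DR : 0 < D%:R :> R by rewrite ltr0n.
have lD : ln D.+1%:R <= ln D%:R + D%:R^-1 :> R.
  have -> : D.+1%:R = D%:R * (1 + D%:R^-1) :> R.
    by rewrite mulrDr mulr1 mulfV ?lt0r_neq0 // natr1.
  have D1 : 0 < D%:R^-1 :> R by rewrite invr_gt0.
  rewrite lnM ?posrE ?addr_gt0 // lerD2l; apply: le_ln1Dx; lra.
have := ler_wpM2l (ler0n R i) lD.
move: h; rewrite mulrDr; lra.
Qed.

(** With o = i / 2 + del / 2 odd steps, the logarithm of the orbit after
k = i + o steps of Col differs from ln m - k lam / 3 by
del (ln 3 / 2 + lam / 6), because ln 3 / 2 - ln 2 + lam / 2 = 0.  The other
errors come from the added ones, at most i / D, and from the d = k - (i + o)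
steps between the chosen shortcut time and k, each changing the logarithm by
at most 2 ln 2.  The time al * n stops short of n ln 2 / (lam / 2) by a
fraction of order kap, which keeps the orbit above D and d of order kap * n. *)
Lemma Col_log_bounds (R : realType) (n h m k D : nat) (al e kap : R) :
  let lam := 2 * ln 2 - ln 3 in
  (0 < m)%N -> (0 < D)%N -> 0 <= al -> 0 < kap -> e <= kap -> e <= kap * lam / 4 ->
  al * lam = 2 * ln 2 - kap * lam -> al <= kap * D%:R ->
  (n%:R - h%:R) * ln 2 <= ln m%:R :> R -> ln m%:R <= n%:R * ln 2 :> R ->
  ln D%:R <= kap * lam / 4 * n%:R - h%:R * ln 2 ->
  ~~ drifting n al e m -> k%:R * lam <= 3 * ln m%:R ->
  `|ln (iter k Col m)%:R + k%:R * lam / 3 - ln m%:R| <= 9 * kap * n%:R + 5.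
Proof.
move=> lam m0 D0 al0 kap0 ek ekl allam alD Mlo Mhi lnD nodrift kM.
have L2h := half_le_ln2 R; have L21 := ln2_le1 R; have L23 := ln2_le_ln3 R.
have L3lt := ln3_lt_2ln2 R; have L32 := ln3_lt2 R.
have lam0 : 0 < lam by rewrite subr_gt0.
have lam1 : lam <= 1 by rewrite /lam; clear -L21 L23; lra.
have n0 : 0 <= n%:R :> R by [].
have calm j : j%:R <= al * n%:R -> `|2 * (ones (parity j m))%:R - j%:R| <= e * n%:R.
  move=> jal; rewrite leNgt; apply: contra nodrift => dev.
  by apply/asboolP; exists j.
have enk : e * n%:R <= kap * n%:R by rewrite ler_wpM2r.
have enl : e * n%:R <= kap * lam / 4 * n%:R by rewrite ler_wpM2r.
(* At time al * n the logarithm is still about kap * lam / 2 * n; half of this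
is enough to absorb the drift and the shift by h. *)
have big j : j%:R <= al * n%:R -> (D <= iter j shortcut m)%N.
  move=> jal; rewrite -(ler_nat R).
  have X0 : 0 < (iter j shortcut m)%:R :> R by rewrite ltr0n shortcut_gt0.
  rewrite -ler_ln ?posrE ?ltr0n ?shortcut_gt0 //; apply: le_trans _ (shortcut_log_lower R j m0).
  have := calm j jal; rewrite ler_norml => /andP[c1 c2].
  have h1 : (j%:R - e * n%:R) * (ln 3) <= 2 * (ones (parity j m))%:R * ln 3.
    by rewrite ler_wpM2r ?(ltW (ln3_gt0 R)) //; clear -c1; lra.
  have h2 : j%:R * lam <= al * n%:R * lam by rewrite ler_wpM2r // ltW.
  have h3 : al * n%:R * lam = (2 * ln 2 - kap * lam) * n%:R by rewrite -allam; ring.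
  have h4 : e * n%:R * ln 3 <= kap * lam / 4 * n%:R * 2.
    apply: le_trans (_ : _ <= kap * lam / 4 * n%:R * ln 3) _.
      by rewrite ler_wpM2r ?(ltW (ln3_gt0 R)).
    by rewrite ler_wpM2l // !mulr_ge0 // ?ltW // invr_ge0.
  have h5 : j%:R * lam = 2 * j%:R * ln 2 - j%:R * ln 3 by rewrite /lam; ring.
  by clear -h1 h2 h3 h4 h5 Mlo lnD; lra.
have an0 : 0 <= al * n%:R by rewrite mulr_ge0.
have /andP[i0lo i0hi] := truncn_itv an0.
set i0 := Num.truncn _ in i0lo i0hi.
have [i [ii0 iok alt]] := Col_window i0 k m.
have ial : i%:R <= al * n%:R by apply: le_trans _ i0lo; rewrite ler_nat.
have oi := calm i ial; move: iok alt oi; set o := ones (parity i m) => iok alt oi.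
have := oi; rewrite ler_norml => /andP[olo ohi].
have Xlo := shortcut_log_lower R i m0; rewrite -/o in Xlo.
have Xhi : ln (iter i shortcut m)%:R <= o%:R * ln 3 - i%:R * ln 2 + ln m%:R + i%:R / D%:R :> R.
  apply: shortcut_log_upper => // j ji; apply: big; apply: le_trans _ ial.
  by rewrite ler_nat ltnW.
have DR : 0 < D%:R :> R by rewrite ltr0n.
have iD : i%:R / D%:R <= kap * n%:R.
  rewrite ler_pdivrMr //; apply: le_trans ial _.
  have -> : kap * n%:R * D%:R = kap * D%:R * n%:R by ring.
  by rewrite ler_wpM2r.
pose d := (k - (i + o))%N.
have kE : k = (d + (i + o))%N by rewrite subnK.
have kR : k%:R = d%:R + i%:R + o%:R :> R by rewrite kE !natrD addrA.
have CE : iter k Col m = iter d Col (iter i shortcut m) by rewrite kE iterD iter_Col_shortcut.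
have [C0 Clo Chi] := Col_steps d (shortcut_gt0 i m0); rewrite -CE in C0 Clo Chi.
have := @ler_ln_nat R _ _ (shortcut_gt0 i m0) Clo.
have := @ler_ln_nat R _ _ C0 Chi.
rewrite !ln_mul_nat ?expn_gt0 ?shortcut_gt0 // !ln_exp_nat //.
have -> : ln 4%:R = 2 * ln 2 :> R by rewrite (ln_exp_nat R 2 (a := 2)).
move=> {}Chi {}Clo.
have d0 : 0 <= d%:R :> R by [].
have dle : d%:R <= 2 * kap * n%:R + 3 / 2.
  case: alt => [near|ii].
    have : d%:R <= 1%:R :> R by rewrite ler_nat /d leq_subLR addn1.
    have : 0 <= kap * n%:R by rewrite mulr_ge0 // ltW.
    by clear; lra.
  rewrite -(ler_pM2r lam0).
  have i0R : al * n%:R - 1 <= i%:R by rewrite ii lerBlDr natr1 ltW.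
  have io : 3 / 2 * (al * n%:R - 1) - e * n%:R / 2 <= i%:R + o%:R.
    by clear -i0R olo; lra.
  have h1 : (3 / 2 * (al * n%:R - 1) - e * n%:R / 2) * lam <= (i%:R + o%:R) * lam.
    by rewrite ler_wpM2r // ltW.
  have h2 : al * n%:R * lam = (2 * ln 2 - kap * lam) * n%:R by rewrite -allam; ring.
  have h3 : e * n%:R * lam <= kap * n%:R * lam by rewrite ler_wpM2r // ltW.
  have h4 : k%:R * lam = d%:R * lam + (i%:R + o%:R) * lam by rewrite kR; ring.
  by clear -h1 h2 h3 h4 kM Mhi; lra.
pose del : R := 2 * o%:R - i%:R.
have del1 : del * (ln 3 / 2 + lam / 6) <= 3 / 2 * (e * n%:R).
  apply: (@le_trans _ _ (e * n%:R * (ln 3 / 2 + lam / 6))).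
    by rewrite ler_wpM2r // addr_ge0 // divr_ge0 ?ler0n // ?(ltW (ln3_gt0 R)) // ltW.
  have en0 : 0 <= e * n%:R by exact: le_trans (normr_ge0 _) oi.
  by rewrite [leRHS]mulrC ler_wpM2l //; clear -L32 lam1; lra.
have del2 : - (3 / 2 * (e * n%:R)) <= del * (ln 3 / 2 + lam / 6).
  apply: (@le_trans _ _ (- (e * n%:R) * (ln 3 / 2 + lam / 6))).
    have en0 : 0 <= e * n%:R by exact: le_trans (normr_ge0 _) oi.
    by rewrite mulNr lerN2 [leRHS]mulrC ler_wpM2l //; clear -L32 lam1; lra.
  by rewrite ler_wpM2r // addr_ge0 // divr_ge0 ?ler0n // ?(ltW (ln3_gt0 R)) // ltW.
have main : o%:R * ln 3 - i%:R * ln 2 + (i%:R + o%:R) * lam / 3 =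
    del * (ln 3 / 2 + lam / 6) by rewrite /del /lam; field.
have kl : k%:R * lam / 3 = d%:R * lam / 3 + (i%:R + o%:R) * lam / 3 by rewrite kR; ring.
have dl0 : 0 <= d%:R * lam by rewrite mulr_ge0 // ltW.
have dl1 : d%:R * lam <= d%:R by rewrite -[leRHS]mulr1 ler_wpM2l.
have dL : d%:R * ln 2 <= d%:R :> R by rewrite -[leRHS]mulr1 ler_wpM2l.
have dL0 : 0 <= d%:R * ln 2 :> R by rewrite mulr_ge0 //; clear -L2h; lra.
by rewrite ler_norml; apply/andP; split;
  clear -Chi Clo Xlo Xhi iD dle del1 del2 main kl dl0 dl1 dL dL0 enk; lra.
Qed.

(** The parameter h lets one dyadic scale n handle all m between 2 ^ (n - h) and
2 ^ n. *)
Lemma undrifted_orbits (R : realType) (eps : R) (h : nat) : 0 < eps ->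
  exists al e : R, [/\ al * (1 - ln 3 / (2 * ln 2)) < 1, 0 < e &
  \forall n \near \oo, forall m k,
    (2 ^ n <= m * 2 ^ h)%N -> (m < 2 ^ n)%N -> ~~ drifting n al e m ->
    k%:R * (2 * ln 2 - ln 3) <= 3 * ln m%:R :> R ->
    `|ln (iter k Col m)%:R + k%:R * (2 * ln 2 - ln 3) / 3 - ln m%:R|
      <= eps * ln m%:R].
Proof.
move=> eps0.
have L2h := half_le_ln2 R; have L21 := ln2_le1 R; have L23 := ln2_le_ln3 R.
have L3lt := ln3_lt_2ln2 R.
set lam := 2 * ln 2 - ln 3.
have lam0 : 0 < lam by rewrite subr_gt0.
have lam1 : lam <= 1 by rewrite /lam; clear -L21 L23; lra.
pose kap := Num.min 1 (eps / 40).
have kap0 : 0 < kap by rewrite lt_min ltr01 /=; clear -eps0; lra.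
have kap1 : kap <= 1 by rewrite ge_min lexx.
have kape : kap <= eps / 40 by rewrite ge_min lexx orbT.
have kl1 : kap * lam <= 1 by rewrite mulr_ile1 // ltW.
have kl0 : 0 < kap * lam by rewrite mulr_gt0.
pose e := Num.min kap (kap * lam / 4).
have ek : e <= kap by rewrite ge_min lexx.
have ekl : e <= kap * lam / 4 by rewrite ge_min lexx orbT.
have e0 : 0 < e by rewrite lt_min kap0 /=; clear -kl0; lra.
pose al := (2 * ln 2 - kap * lam) / lam.
have allam : al * lam = 2 * ln 2 - kap * lam by rewrite /al mulfVK // lt0r_neq0.
have al0 : 0 <= al by apply: divr_ge0; [clear -L2h kl1; lra | exact: ltW].
pose D := (Num.truncn (al / kap)).+1.
have alD : al <= kap * D%:R.
  rewrite mulrC -ler_pdivrMr //.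
  by have /andP[_ /ltW] := truncn_itv (divr_ge0 al0 (ltW kap0)).
have L20 : 0 < 2 * ln 2 :> R by clear -L2h; lra.
exists al, e; split => //.
  have -> : 1 - ln 3 / (2 * ln 2) = lam / (2 * ln 2).
    by rewrite /lam mulrBl mulfV // lt0r_neq0.
  rewrite mulrA allam ltr_pdivrMr // mul1r; clear -kl0; lra.
have c1 : 0 < kap * lam / 4 by clear -kl0; lra.
have c2 : 0 < eps * (11 / 40) by clear -eps0; lra.
have n1 := near_linear (ln D%:R + h%:R * ln 2) c1.
have n2 := near_linear (5 + eps * h%:R) c2.
near=> n => m k mn mlt nodrift kM.
have hn1 : ln D%:R + h%:R * ln 2 <= kap * lam / 4 * n%:R by near: n.
have hn2 : 5 + eps * h%:R <= eps * (11 / 40) * n%:R by near: n.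
have m0 : (0 < m)%N.
  by rewrite lt0n; apply/negP => /eqP m0; move: mn; rewrite m0 mul0n leqNgt expn_gt0.
have Mlo : (n%:R - h%:R) * ln 2 <= ln m%:R :> R.
  have := @ler_ln_nat R _ _ _ mn; rewrite expn_gt0 => /(_ isT).
  by rewrite ln_mul_nat ?expn_gt0 // !ln_exp_nat // => le; clear -le; lra.
have Mhi : ln m%:R <= n%:R * ln 2 :> R.
  by rewrite -(ln_exp_nat R n (a := 2)) //; apply: ler_ln_nat => //; exact: ltnW.
have lnD : ln D%:R <= kap * lam / 4 * n%:R - h%:R * ln 2 by clear -hn1; lra.
have := Col_log_bounds m0 (ltn0Sn _) al0 kap0 ek ekl allam alD Mlo Mhi lnD nodrift kM.
move/le_trans; apply.
have h1 : eps * ((n%:R - h%:R) * ln 2) <= eps * ln m%:R by rewrite ler_pM2l.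
have h2 : kap * n%:R <= eps / 40 * n%:R by rewrite ler_wpM2r.
have h3 : eps * n%:R * 2^-1 <= eps * n%:R * ln 2.
  by rewrite ler_wpM2l // mulr_ge0 // ltW.
have h4 : eps * h%:R * ln 2 <= eps * h%:R.
  by rewrite -[leRHS]mulr1 ler_wpM2l // mulr_ge0 // ltW.
by clear -h1 h2 h3 h4 hn2; lra.
Unshelve. all: by end_near. Qed.

Lemma powR_exp (R : realType) (a x : R) : 0 < a -> a `^ x = expR (x * ln a).
Proof. by move=> a0; rewrite /powR gt_eqF. Qed.

Lemma log_to_pow (R : realType) (eps : R) (k m c : nat) : (0 < m)%N -> (0 < c)%N ->
  `|ln c%:R + k%:R * (2 * ln 2 - ln 3) / 3 - ln m%:R| <= eps * ln m%:R ->
  ((3 / 4 : R) `^ (3^-1)) ^+ k * (m%:R : R) `^ (1 - eps) <= c%:R /\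
  c%:R <= ((3 / 4 : R) `^ (3^-1)) ^+ k * (m%:R : R) `^ (1 + eps).
Proof.
move=> m0 c0; rewrite ler_norml => /andP[lo hi].
have q0 : 0 < 3 / 4 :> R by lra.
rewrite !powR_exp ?ltr0n //.
have -> : ln (3 / 4) = ln 3 - 2 * ln 2 :> R.
  by rewrite ln_div ?posrE // (ln_exp_nat R 2 (a := 2)).
rewrite -expRM_natr -!expRD -[c%:R](@lnK R) ?posrE ?ltr0n // !ler_expR.
by split; move: lo hi; set L3 := ln 3; lra.
Qed.

Lemma time_bound (R : realType) (k m : nat) :
  k%:R <= 3 * log2 (m%:R : R) / (2 - log2 (3 : R)) ->
  k%:R * (2 * ln 2 - ln 3) <= 3 * ln m%:R :> R.
Proof.
have L2 := half_le_ln2 R; have L3 := ln3_lt_2ln2 R.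
have L20 : 0 < ln 2 :> R by clear -L2; lra.
have lam0 : 0 < 2 * ln 2 - ln 3 :> R by rewrite subr_gt0.
rewrite /log2; have -> : 2 - ln 3 / ln 2 = (2 * ln 2 - ln 3) / ln 2 :> R.
  by rewrite mulrBl mulfK // lt0r_neq0.
have -> : 3 * (ln m%:R / ln 2) / ((2 * ln 2 - ln 3) / ln 2) =
   3 * ln m%:R / (2 * ln 2 - ln 3) :> R.
  by field; rewrite !lt0r_neq0.
by rewrite ler_pdivlMr.
Qed.

(** * Natural density *)

Lemma count_uptoE (A : set nat) N :
  count_upto A N = count (fun m => m \in A) (iota 1 N).
Proof.
rewrite /count_upto -sum1_card countE.
rewrite (big_mkcond) -(big_mkord xpredT (fun m => if (0 < m)%N && (m \in A) then 1 else 0)%N).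
rewrite big_ltn // /index_iota subn1 /=; apply: eq_big_seq => m.
by rewrite mem_iota => /andP[-> _] /=; case: (m \in A).
Qed.

Lemma natural_density_oneI (R : realType) (A : set nat) :
  (forall d : R, 0 < d -> \forall N \near \oo,
    (count (fun m => m \notin A) (iota 1 N))%:R <= d * N%:R) ->
  natural_density_one R A.
Proof.
move=> small; rewrite /natural_density_one.
suff cv : (fun n : nat => ((count_upto A n)%:R / n%:R : R)%:E) @ \oo --> 1%E.
  by have [] := cvg_limn_einf_sup cv.
apply/cvg_EFin; first by near=> n.
apply/cvgrPdist_le => d d0; near=> n.
have n0 : (0 < n)%N by near: n; exact: nbhs_infty_gt.
have nR : 0 < n%:R :> R by rewrite ltr0n.
have le : (count (fun m => m \notin A) (iota 1 n))%:R <= d * n%:R :> R by near: n; exact: small.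
have tot : (count_upto A n)%:R + (count (fun m => m \notin A) (iota 1 n))%:R = n%:R :> R.
  by rewrite -natrD count_uptoE count_predC size_iota.
have -> : 1 - ((count_upto A n)%:R / n%:R) = (count (fun m => m \notin A) (iota 1 n))%:R / n%:R :> R.
  rewrite -[X in X - _](mulfV (lt0r_neq0 nR)) -mulrBl; congr (_ / _).
  by rewrite -{1}tot addrC addKr.
by rewrite ger0_norm ?divr_ge0 // ler_pdivrMr.
Unshelve. all: by end_near. Qed.

Lemma dyadic_count (P Q : pred nat) (n h N : nat) : (h <= n)%N -> (N < 2 ^ n)%N ->
  (forall m, (0 < m)%N -> (m < 2 ^ n)%N -> (2 ^ n <= m * 2 ^ h)%N -> P m -> Q m) ->
  (count P (iota 1 N) <= 2 ^ (n - h) + count Q (iota 0 (2 ^ n)))%N.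
Proof.
move=> hn Nn sub.
have : (count P (iota 1 N) <= count (fun m => (m < 2 ^ (n - h))%N) (iota 1 N) + count Q (iota 1 N))%N.
  rewrite -count_predUI; apply: leq_trans (leq_addr _ _).
  rewrite -!size_filter; apply: uniq_leq_size; first by rewrite filter_uniq ?iota_uniq.
  move=> m; rewrite !mem_filter mem_iota => /andP[Pm /andP[m0 mN]].
  rewrite m0 mN !andbT /=; case: ltnP => //= big; apply: sub => //.
    exact: leq_trans mN Nn.
  by rewrite -(subnK hn) expnD leq_mul2r big orbT.
move/leq_trans; apply; apply: leq_add.
  rewrite -size_filter -[leqRHS](size_iota 0); apply: uniq_leq_size.
    by rewrite filter_uniq ?iota_uniq.
  by move=> m; rewrite mem_filter [m \in iota 0 _]mem_iota add0n => /andP[].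
rewrite -!size_filter; apply: uniq_leq_size; first by rewrite filter_uniq ?iota_uniq.
move=> m; rewrite !mem_filter => /andP[-> ]; rewrite !mem_iota /= => /andP[_ mN].
exact: leq_trans mN Nn.
Qed.

Theorem theorem1p9 (R : realType) (eps : R) (eps_gt0 : 0 < eps) :
  natural_density_one R
    [set m : nat | (0 < m)%N /\
      forall k : nat,
        k%:R <= 3 * log2 (m%:R : R) / (2 - log2 (3 : R)) ->
        ((3 / 4 : R) `^ (3^-1)) ^+ k * (m%:R : R) `^ (1 - eps)
          <= (iter k Col m)%:R
        /\ (iter k Col m)%:R
          <= ((3 / 4 : R) `^ (3^-1)) ^+ k * (m%:R : R) `^ (1 + eps)].
Proof.
apply: natural_density_oneI => d d0.
have [h hd] : exists h : nat, 2 * 2 ^- h <= d / 2.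
  have c0 : 0 < ln 2 :> R := ln2_gt0 R.
  have d4 : 0 < d / 4 by lra.
  have [h _ /(_ h (leqnn h)) /= le] := near_exp_small c0 d4.
  exists h; move: le; rewrite expRN mulrC (expR_ln_nat R h (n := 2)) //; lra.
have [al [e [al1 e0 [n0 _ good]]]] := undrifted_orbits h eps_gt0.
have [c c0 [n1 _ rare]] := concentrated_all al1 e0.
have d4 : 0 < d / 4 by lra.
have [n2 _ small] := near_exp_small c0 d4.
near=> N.
have Nbig : (2 ^ (n0 + n1 + n2 + h) <= N)%N by near: N; exact: nbhs_infty_ge.
have N0 : (0 < N)%N by apply: leq_trans Nbig; rewrite expn_gt0.
have /andP[Nlo Nhi] := trunc_log_bounds (isT : (1 < 2)%N) N0.
have nbig := trunc_log_max (isT : (1 < 2)%N) Nbig.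
(* The scale with 2 ^ (n - 1) <= N < 2 ^ n. *)
set n := (trunc_log 2 N).+1 in Nhi.
have nbig' : (n0 + n1 + n2 + h <= n)%N by exact: leqW.
have hn : (h <= n)%N := leq_trans (leq_addl _ _) nbig'.
have n0n : (n0 <= n)%N.
  by apply: leq_trans nbig'; rewrite -!addnA leq_addr.
have n1n : (n1 <= n)%N.
  by apply: leq_trans nbig'; rewrite -!addnA addnCA leq_addr.
have n2n : (n2 <= n)%N.
  by apply: leq_trans nbig'; rewrite addnAC leq_addl.
set A := [set m | _].
have := @dyadic_count (fun m => m \notin A) (drifting n al e) n h N hn Nhi.
move=> bound; have {}bound : (count (fun m => m \notin A) (iota 1 N) <=
   2 ^ (n - h) + count (drifting n al e) (iota 0 (2 ^ n)))%N.
  apply: bound => m m0 mn mh; apply: contraR => nodrift; rewrite inE /A /=; split => // k hk.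
  apply: log_to_pow => //.
    by case: (Col_steps k m0).
  by apply: (good n n0n) => //; exact: time_bound.
apply: (@le_trans _ _ (2 ^ (n - h) + count (drifting n al e) (iota 0 (2 ^ n)))%N%:R).
  by rewrite ler_nat.
have N2 : 2 ^+ n <= 2 * N%:R :> R by rewrite /n exprS ler_pM2l // -natrX ler_nat.
have r1 := rare n n1n; have r2 := small n n2n; rewrite /= in r1 r2.
have s1 : (2 ^ (n - h))%:R = 2 ^+ n * 2 ^- h :> R.
  by rewrite natrX exprB // ?unitfE // expr_div_n.
have r1' : (count (drifting n al e) (iota 0 (2 ^ n)))%:R <= 2 ^+ n * (d / 4).
  apply: le_trans r1 _; have -> : n%:R * (ln 2 - c) = n%:R * ln 2 - c * n%:R by ring.
  by rewrite expRD -exp2E ler_pM2l ?exprn_gt0.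
have s2 : 2 ^+ n * 2 ^- h <= 2 ^+ n * (d / 4) :> R.
  by rewrite ler_pM2l ?exprn_gt0 //; lra.
rewrite natrD s1; apply: le_trans (lerD s2 r1') _.
have : 2 ^+ n * (d / 2) <= 2 * N%:R * (d / 2) by rewrite ler_wpM2r //; lra.
lra.
Unshelve. all: by end_near. Qed.
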